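(* For $\epsilon>0$, an $\epsilon$-approximation of the (non-discounted) expected saved cost $s(\pi_\mu)$ is given by $$\tilde s_\epsilon(\pi_\mu)=\sum_{i=0}^{\tilde k_\epsilon}(1-\rho_\mu)\rho_\mu^i\big(H^\ast(i,0)-\tilde H_{\epsilon/2}(i,1)\big),$$ i.e. $|s(\pi_\mu)-\tilde s_\epsilon(\pi_\mu)|\le\epsilon$, where $$\tilde k_\epsilon=\Big\lceil\log_{\rho_\mu\zeta}\Big(\frac{\epsilon(1-\eta)(1-\rho_\mu\zeta)}{4u_M(1-\rho_\mu)}\Big)\Big\rceil$$ and $\tilde H_{\epsilon/2}(i,1)=V'_{\beta,\tilde n_{\epsilon/2,\tilde k_\epsilon}}(i)$, $i=0,1,\dots,\tilde k_\epsilon$, are the $\epsilon/2$-approximations of $H^\ast(i,1)$ obtained by Value Iteration in the $\beta$-discounted auxiliary model.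
   Context: Model. Real parameters $\lambda,\beta>0$ and $0<\mu_1<\mu_2$ satisfy $\lambda+\mu_1+\mu_2+\beta=1$; service cost rates $0=c_{\mu_1}<c_{\mu_2}$; a fixed rate $\mu\in\{\mu_1,\mu_2\}$ with $\mu>\lambda$. The holding cost $h:\mathbb{N}_0\to\mathbb{R}$ satisfies $h(0)=0$, is non-negative, non-decreasing, convex, unbounded, and $\sum_{i\ge 0}h(i)x^i<\infty$ for all $0<x<1$. State space $S=\mathbb{N}_0\times\{0,1\}$. $\Phi$ is the set of stationary deterministic policies $\phi$, with $\phi(i,1)\in\{\mu_1,\mu_2\}$, $\phi(i,0)=\mu$. Transition probabilities $p^\phi_{xy}$: from $(i,1)$ with $a=\phi(i,1)$, to $(i+1,1)$ w.p. $\lambda$, to $(i,0)$ w.p. $\beta$, to $(i-1,1)$ w.p. $a\mathbf 1_{\{i>0\}}$, to $(i,1)$ otherwise; from $(i,0)$, to $(i+1,0)$ w.p. $\lambda$, to $(i-1,0)$ w.p. $\mu\mathbf 1_{\{i>0\}}$, to $(i,0)$ otherwise. Costs $c^\phi(i,1)=c_{\phi(i,1)}+h(i)$, $c^\phi(i,0)=c_\mu+h(i)$. $\rho_\mu=\lambda/\mu$, $\pi_\mu(i)=(1-\rho_\mu)\rho_\mu^i$. Saved cost. Let $\pi_\mu^0,\pi_\mu^1$ be the distributions on $S$ with $\pi_\mu^0(i,0)=\pi_\mu(i)=\pi_\mu^1(i,1)$ for $i\in\mathbb{N}_0$ and all other entries zero. For $\phi\in\Phi$, $$s^\phi(\pi_\mu)=\mathbb{E}^\phi_{\pi_\mu^0\times\pi_\mu^1}\Big[\sum_{n=0}^\infty\big(c^\phi(X_n)-c^\phi(Y_n)\big)\Big],$$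 where $(X_n)$, $(Y_n)$ are the chains under $\phi$ with initial states $(X_0,Y_0)$ distributed as $\pi_\mu^0\times\pi_\mu^1$; $s(\pi_\mu)=\sup_{\phi\in\Phi}s^\phi(\pi_\mu)$. Weight function. Fix $\zeta$ with $1<\zeta<1/(1-\beta)$, and in addition: if $\mu_1>\lambda$, $\zeta<\min\{\mu_1/\lambda,\,1+\beta/\lambda\}$; if $\mu_1\le\lambda<\mu_2$ (so $\mu=\mu_2$), $\zeta<\min\Big\{1+\frac\beta\lambda,\ \frac\mu\lambda,\ \frac{(\lambda+\frac12\beta+\mu_1)+\sqrt{(\lambda+\frac12\beta+\mu_1)^2-4\lambda\mu_1}}{2\lambda}\Big\}$. Let $M(i,0)=\frac12\zeta^i$, $M(i,1)=\zeta^i$, $\|f\|_M=\sup_{x\in S}|f(x)|/M(x)$, and $$\eta=1-\lambda+\lambda\zeta+\max\Big\{-\beta,\,-\big(1-\tfrac1\zeta\big)\mu,\,-\big(1-\tfrac1\zeta\big)\mu_1-\tfrac12\beta\Big\}<1.$$ Let $g^\ast=g_\mu=c_\mu+(1-\rho_\mu)\sum_{i\ge0}h(i)\rho_\mu^i$. $H^\ast:S\to\mathbb{R}$ is the unique function with $\|H^\ast\|_M<\infty$, $H^\ast(0,0)=0$ and $g^\ast+H^\ast(x)=\min_{\phi\in\Phi}\{c^\phi(x)+\sum_yp^\phi_{xy}H^\ast(y)\}$ for all $x\in S$. $u_M$ is a constant with $u_M\ge\max\{\sup_{\phi}\|c^\phi\|_M,\|g^\ast\mathbf 1\|_M\}$,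 $\mathbf 1$ the constant function one. $\beta$-discounted auxiliary model on $\mathbb{N}_0$: its Value Iteration is $V'_{\beta,0}\equiv0$ and $$V'_{\beta,n+1}(i)=\min_{a\in\{\mu_1,\mu_2\}}\big\{c_a+h(i)-g_\mu+\beta H^\ast(i,0)+a\mathbf 1_{\{i>0\}}V'_{\beta,n}(i-1)+(1-\beta-\lambda-a\mathbf 1_{\{i>0\}})V'_{\beta,n}(i)+\lambda V'_{\beta,n}(i+1)\big\}$$ (for $i=0$ the term with $V'_{\beta,n}(-1)$ is absent). For $\epsilon'>0,k\in\mathbb{N}_0$, $$\tilde n_{\epsilon',k}=\Big\lceil\log_{(1-\beta)\zeta}\Big(\frac{\epsilon'(1-(1-\beta)\zeta)}{\tilde K\zeta^k}\Big)\Big\rceil,\quad \tilde K=g_\mu+u_M+\frac{\beta u_M}{1-\eta}.$$ *)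

(* Defs.v *)
From HB Require Import structures.
From mathcomp Require Import all_boot all_order all_algebra.
From mathcomp Require Import all_classical all_reals all_analysis.

Set Implicit Arguments.
Unset Strict Implicit.
Unset Printing Implicit Defensive.

Import Order.TTheory GRing.Theory Num.Theory.
Import numFieldNormedType.Exports.

Local Open Scope classical_set_scope.
Local Open Scope ring_scope.

(* The state (i, true) is the paper's (i, 1), where the service rate is
   controlled; (i, false) is (i, 0), where it is fixed. *)
Notation state := (nat * bool)%type.

Record model (R : realType) := Model {
  lambda : R;
  beta : R;
  mu1 : R;
  mu2 : R;
  mu : R;
  cost_rate : R -> R; (* a |-> c_a; only used at a = mu1 and a = mu2 *)
  h : nat -> R;
  lambda_gt0 : 0 < lambda;
  beta_gt0 : 0 < beta;
  mu1_gt0 : 0 < mu1;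
  mu1_lt_mu2 : mu1 < mu2;
  rates_sum1 : lambda + mu1 + mu2 + beta = 1;
  cost_mu1 : cost_rate mu1 = 0;
  cost_mu2_gt0 : 0 < cost_rate mu2;
  mu_in : mu = mu1 \/ mu = mu2;
  lambda_lt_mu : lambda < mu;
  h0 : h 0%N = 0;
  h_ge0 : forall i, 0 <= h i;
  h_nondecreasing : forall i j, (i <= j)%N -> h i <= h j;
  h_convex : forall i, h i.+1 - h i <= h i.+2 - h i.+1;
  h_unbounded : forall B : R, exists i, B < h i;
  h_summable : forall x : R, 0 < x < 1 -> cvgn (series (fun i => h i * x ^+ i))
}.

Record policy (R : realType) (m : model R) := Policy {
  rate :> state -> R;
  rate1 : forall i, rate (i, true) = mu1 m \/ rate (i, true) = mu2 m;
  rate0 : forall i, rate (i, false) = mu m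
}.

Section Model.
Context {R : realType} (m : model R).

(* For i = 0 the coefficient of the (meaningless) state (i.-1, _) is 0. *)
Definition trans (phi : policy m) (x y : state) : R :=
  let i := x.1 in
  let a := phi x * (0 < i)%N%:R in
  if x.2 then
    lambda m * (y == (i.+1, true))%:R + beta m * (y == (i, false))%:R
    + a * (y == (i.-1, true))%:R
    + (1 - lambda m - beta m - a) * (y == (i, true))%:R
  else
    lambda m * (y == (i.+1, false))%:R + a * (y == (i.-1, false))%:R
    + (1 - lambda m - a) * (y == (i, false))%:R.

Definition cost (phi : policy m) (x : state) : R :=
  cost_rate m (phi x) + h m x.1.

Definition rho_mu : R := lambda m / mu m.

Definition pi_mu (i : nat) : R := (1 - rho_mu) * rho_mu ^+ i.

Definition pi_mu0 (x : state) : R := if x.2 then 0 else pi_mu x.1.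
Definition pi_mu1 (x : state) : R := if x.2 then pi_mu x.1 else 0.

Definition g_mu : R :=
  cost_rate m (mu m)
  + (1 - rho_mu) * limn (series (fun i => h m i * rho_mu ^+ i)).

(* The Markov property, in product form so as to make sense also when the
   conditioning event has probability 0. *)
Definition markov_chain (phi : policy m) d (Omega : measurableType d)
    (P : probability Omega R) (X : nat -> {RV P >-> state}) : Prop :=
  forall (n : nat) (s : nat -> state),
    P [set w | forall k, (k <= n.+1)%N -> X k w = s k] =
    (P [set w | forall k, (k <= n)%N -> X k w = s k]
     * (trans phi (s n) (s n.+1))%:E)%E.

(* A pair of chains under phi with initial distribution pi_mu0 x pi_mu1.  No
   further assumption is made on their joint law (independence, or some
   coupling): the expectations used below do not depend on it. *)
Record chain_pair (phi : policy m) := ChainPair {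
  disp : measure_display;
  Omega : measurableType disp;
  Prob : probability Omega R;
  chX : nat -> {RV Prob >-> state};
  chY : nat -> {RV Prob >-> state};
  chX_markov : markov_chain phi chX;
  chY_markov : markov_chain phi chY;
  ch_init : forall x y : state,
    Prob [set w | chX 0%N w = x /\ chY 0%N w = y]
    = (pi_mu0 x * pi_mu1 y)%:E
}.

Definition partial_saved_cost (phi : policy m) (Z : chain_pair phi) (N : nat)
    : \bar R :=
  'E_(Prob Z)[fun w =>
    \sum_(0 <= n < N) (cost phi (chX Z n w) - cost phi (chY Z n w))].

(* The expectation of the infinite sum is the limit of the expectations of the
   partial sums: in general (e.g. for independent chains) the series does not
   converge pathwise. *)
Definition saved_cost_of (phi : policy m) (Z : chain_pair phi) : \bar R :=
  limn (partial_saved_cost Z).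

Definition saved_cost (Z : forall phi : policy m, chain_pair phi) : \bar R :=
  ereal_sup (range (fun phi => saved_cost_of (Z phi))).

Record admissible_zeta (zeta : R) : Prop := AdmissibleZeta {
  zeta_gt1 : 1 < zeta;
  zeta_lt : zeta < 1 / (1 - beta m);
  zeta_stable : lambda m < mu1 m ->
    zeta < Num.min (mu1 m / lambda m) (1 + beta m / lambda m);
  zeta_unstable : mu1 m <= lambda m < mu2 m ->
    let b := lambda m + beta m / 2 + mu1 m in
    zeta < Num.min (1 + beta m / lambda m)
             (Num.min (mu m / lambda m)
                ((b + Num.sqrt (b ^+ 2 - 4 * lambda m * mu1 m))
                 / (2 * lambda m)))
}.

Section Weight.
Variable zeta : R.

Definition weight (x : state) : R :=
  (if x.2 then 1 else 2^-1) * zeta ^+ x.1.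

Definition wnorm (f : state -> R) : \bar R :=
  ereal_sup (range (fun x => (`|f x| / weight x)%:E)).

Definition eta : R :=
  1 - lambda m + lambda m * zeta
  + Num.max (- beta m)
      (Num.max (- ((1 - zeta^-1) * mu m))
         (- ((1 - zeta^-1) * mu1 m) - beta m / 2)).

Definition is_min (A : set R) (v : R) : Prop := A v /\ lbound A v.

Record is_Hstar (H : state -> R) : Prop := IsHstar {
  Hstar_bounded : (wnorm H < +oo)%E;
  Hstar_00 : H (0%N, false) = 0;
  Hstar_opt : forall x : state,
    is_min
      (range (fun phi : policy m =>
         cost phi x + \sum_(y \in [set: state]) trans phi x y * H y))
      (g_mu + H x)
}.

Definition is_uM (uM : R) : Prop :=
  (maxe (ereal_sup (range (fun phi : policy m => wnorm (cost phi))))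
        (wnorm (fun=> g_mu)) <= uM%:E)%E.

End Weight.

Fixpoint VI (H : state -> R) (n : nat) (i : nat) : R :=
  if n is n'.+1 then
    let Q a :=
      let a' := a * (0 < i)%N%:R in
      cost_rate m a + h m i - g_mu + beta m * H (i, false)
      + a' * VI H n' i.-1
      + (1 - beta m - lambda m - a') * VI H n' i
      + lambda m * VI H n' i.+1 in
    Num.min (Q (mu1 m)) (Q (mu2 m))
  else 0.

Definition log_base (b x : R) : R := ln x / ln b.

Definition pos_part (z : int) : nat := if z is Posz n then n else 0%N.

(* The two ceilings below are integers that can be negative when epsilon is
   large.  No iteration is then made (resp. the sum of the approximation is
   empty). *)

Definition n_tilde (zeta uM eps : R) (k : int) : int :=
  let r := (1 - beta m) * zeta in
  let K := g_mu + uM + beta m * uM / (1 - eta zeta) in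
  Num.ceil (log_base r (eps * (1 - r) / (K * zeta ^ k))).

Definition k_tilde (zeta uM eps : R) : int :=
  let r := rho_mu * zeta in
  Num.ceil (log_base r
    (eps * (1 - eta zeta) * (1 - r) / (4 * uM * (1 - rho_mu)))).

(* The value at (i, 1) of the eps-approximation of H on 0, ..., k. *)
Definition H_tilde (zeta uM : R) (H : state -> R) (eps : R) (k : int)
    (i : nat) : R :=
  VI H (pos_part (n_tilde zeta uM eps k)) i.

Definition s_tilde (zeta uM : R) (H : state -> R) (eps : R) : R :=
  let k := k_tilde zeta uM eps in
  \sum_(0 <= i < pos_part (k + 1))
    (1 - rho_mu) * rho_mu ^+ i
    * (H (i, false) - H_tilde zeta uM H (eps / 2) k i).

End Model.

(* Main.v *)
Require Import Defs.
From HB Require Import structures.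
From mathcomp Require Import all_boot all_order all_algebra.
From mathcomp Require Import all_classical all_reals all_analysis.
From mathcomp Require Import measurable_realfun ring lra.
Import Order.TTheory GRing.Theory Num.Theory.
Import numFieldNormedType.Exports.
Local Open Scope classical_set_scope.
Local Open Scope ring_scope.

(* Write P for the transition operator of a policy.  On the uncontrolled level
   the increments of a function evolve under the walk killed at the boundary,
   which contracts the weight [zeta ^ i]; since [pi_mu] is invariant, [P ^ n f]
   converges geometrically to the [pi_mu]-mean of [f (., 0)], first on that
   level and then, by the drift [beta], on the controlled one.  As
   [E c(X_n) = g_mu], the saved cost of a policy is the sum over n of
   [g_mu - pi_mu (P ^ n c (., 1))]; the optimality inequality
   [g_mu - c <= P H - H] makes it telescope to at most
   [pi_mu (H (., 0)) - pi_mu (H (., 1))], with equality for the policy that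
   attains the minima.  The truncation error follows from
   [|H| <= uM / (1 - eta) * M], the drift condition for the chain killed at
   [(0, 0)], and the error on [H (i, 1)] from the contraction of the discounted
   Bellman operator by the factor [(1 - beta) zeta]. *)

(** * Elementary estimates: minima, iterated contractions, weighted sums *)

Lemma ler_dist_min {R : realDomainType} (a b c d e : R) :
  `|a - c| <= e -> `|b - d| <= e -> `|Num.min a b - Num.min c d| <= e.
Proof.
rewrite !ler_norml => /andP[h1 h2] /andP[h3 h4].
by rewrite !minEle; case: (leP a b); case: (leP c d) => *; apply/andP; split; lra.
Qed.

(** The a priori bound [C] only starts the iteration: applying [B |-> A + r * B] repeatedly leaves
    the excess [C * r ^+ n] over the fixed point [A / (1 - r)], and this excess vanishes in the
    limit. *)
Lemma contraction_bound {R : realType} {T : Type} (f w : T -> R) (C A r : R) :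
  (forall x, 0 < w x) -> 0 <= C -> 0 <= A -> 0 <= r < 1 ->
  (forall x, `|f x| <= C * w x) ->
  (forall B, 0 <= B -> (forall x, `|f x| <= B * w x) ->
     forall x, `|f x| <= (A + r * B) * w x) ->
  forall x, `|f x| <= A / (1 - r) * w x.
Proof.
move=> w0 C0 A0 /andP[r0 r1] fC fB x.
have r1' : 0 < 1 - r by lra.
have L0 : 0 <= A / (1 - r) by rewrite divr_ge0// ltW.
have it n : forall x, `|f x| <= (A / (1 - r) + C * r ^+ n) * w x.
  elim: n => [|n IH] y.
    by rewrite expr0 mulr1 (le_trans (fC y))// ler_pM2r// lerDr.
  have /fB/(_ IH y) : 0 <= A / (1 - r) + C * r ^+ n.
    by rewrite addr_ge0// mulr_ge0// exprn_ge0.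
  move/le_trans; apply; rewrite ler_pM2r// le_eqVlt; apply/orP; left; apply/eqP.
  by rewrite exprS; field; apply/eqP; lra.
have cv : (fun n => (A / (1 - r) + C * r ^+ n) * w x) @ \oo -->
    (A / (1 - r) + C * 0) * w x.
  apply: cvgMl; apply: cvgD; first exact: cvg_cst.
  by apply: cvgMr; apply: cvg_expr; rewrite ger0_norm.
rewrite mulr0 addr0 in cv.
rewrite -(cvg_lim _ cv)//; apply: limr_ge; first by apply/cvg_ex; eexists; exact: cv.
by near=> n; exact: it.
Unshelve. all: by end_near. Qed.

Lemma le_geometric0 {R : realType} (K q x : R) :
  0 <= q < 1 -> (forall n, x <= K * q ^+ n) -> x <= 0.
Proof.
move=> /andP[q0 q1] h.
have cv : (fun n => K * q ^+ n) @ \oo --> K * 0.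
  by apply: cvgMr; apply: cvg_expr; rewrite ger0_norm.
rewrite mulr0 in cv.
rewrite -(cvg_lim _ cv)//; apply: limr_ge; first by apply/cvg_ex; eexists; exact: cv.
by near=> n; exact: h.
Unshelve. all: by end_near. Qed.

Lemma ler_norm_comb3 {R : realDomainType} (p q r a b c A B C : R) :
  0 <= p -> 0 <= q -> 0 <= r -> `|a| <= A -> `|b| <= B -> `|c| <= C ->
  `|p * a + q * b + r * c| <= p * A + q * B + r * C.
Proof.
move=> p0 q0 r0 hA hB hC.
apply: (le_trans (ler_normD _ _)); apply: lerD; last by rewrite normrM ger0_norm// ler_wpM2l.
by apply: (le_trans (ler_normD _ _)); apply: lerD; rewrite normrM ger0_norm// ler_wpM2l.
Qed.

Lemma ler_norm_comb4 {R : realDomainType} (p q r s a b c d A B C D : R) :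
  0 <= p -> 0 <= q -> 0 <= r -> 0 <= s ->
  `|a| <= A -> `|b| <= B -> `|c| <= C -> `|d| <= D ->
  `|p * a + q * b + r * c + s * d| <= p * A + q * B + r * C + s * D.
Proof.
move=> p0 q0 r0 s0 hA hB hC hD.
apply: (le_trans (ler_normD _ _)); apply: lerD; last by rewrite normrM ger0_norm// ler_wpM2l.
exact: ler_norm_comb3.
Qed.

(** * The transition operator of a policy *)

Section step.
Context {R : realType} {m : model R}.

(** The operator P, (P f)(x) = E[f(X_1) | X_0 = x], in closed form, so that algebraic identities
    about it fall to [ring]; [fsum_trans] and [ssum_trans] identify it with the sums against
    [trans]. *)
Definition step (phi : policy m) (f : state -> R) (x : state) : R :=
  let i := x.1 in
  let a := phi x * (0 < i)%N%:R in
  if x.2 then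
    lambda m * f (i.+1, true) + beta m * f (i, false) + a * f (i.-1, true)
    + (1 - lambda m - beta m - a) * f (i, true)
  else
    lambda m * f (i.+1, false) + a * f (i.-1, false)
    + (1 - lambda m - a) * f (i, false).

(** The birth-death operator on the uncontrolled level; [pi_mu] is its stationary law. *)
Definition walk (f : nat -> R) (i : nat) : R :=
  let a := mu m * (0 < i)%N%:R in
  lambda m * f i.+1 + a * f i.-1 + (1 - lambda m - a) * f i.

Lemma mu_gt0 : 0 < mu m.
Proof. exact: lt_trans (lambda_gt0 m) (lambda_lt_mu m). Qed.

Lemma service_rate_bounds (a : R) : a = mu1 m \/ a = mu2 m ->
  0 <= a <= 1 - lambda m - beta m.
Proof.
have := rates_sum1 m; have := mu1_gt0 m; have := mu1_lt_mu2 m.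
by move=> ? ? ? [|] ->; apply/andP; split; lra.
Qed.

Lemma rate_bounds (phi : policy m) x : 0 <= phi x <= 1 - lambda m - beta m.
Proof.
case: x => i [] ; apply: service_rate_bounds; first exact: rate1.
by rewrite rate0; exact: mu_in.
Qed.

Lemma ind_bounds (a b : R) i : 0 <= a <= b ->
  0 <= a * (0 < i)%N%:R <= b.
Proof. by case: i => [|i] /andP[h1 h2]; rewrite ?mulr0 ?mulr1; apply/andP; split => //; lra. Qed.

(** The level [false] is never left, and its rate is [mu] under every policy. *)
Lemma iter_step_walk phi (f : state -> R) n i :
  iter n (step phi) f (i, false) = iter n walk (fun j => f (j, false)) i.
Proof.
elim: n i => //= n IH i; rewrite /step /walk/= rate0 !IH//.
Qed.

Lemma stepBC phi f c x : step phi (fun y => f y - c) x = step phi f x - c.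
Proof. by case: x => i []; rewrite /step/=; ring. Qed.

Lemma stepB phi f g x : step phi (fun y => f y - g y) x = step phi f x - step phi g x.
Proof. by case: x => i []; rewrite /step/=; ring. Qed.

Lemma step_le phi f g : (forall x, f x <= g x) -> forall x, step phi f x <= step phi g x.
Proof.
move=> fg [i b]; have := ind_bounds _ _ i (rate_bounds phi (i, b)).
have b0 := beta_gt0 m; have l0 := lambda_gt0 m.
rewrite /step/=; set a := phi _ * _ => /andP[a0 a1].
by case: b @a a0 a1 => a a0 a1; rewrite !lerD// ler_wpM2l//; lra.
Qed.

End step.

(** * The stationary mean and geometric ergodicity *)

Section geometric_bound.
Context {R : realType} (m : model R) (zeta : R).
Hypotheses (zeta1 : 1 < zeta) (zetamu : lambda m * zeta < mu m).

Notation l := (lambda m).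
Notation rho := (rho_mu m).

Let l0 : 0 < l. Proof. exact: lambda_gt0. Qed.
Let lmu : l < mu m. Proof. exact: lambda_lt_mu. Qed.
Let mu0 : 0 < mu m := mu_gt0.
Let z0 : 0 < zeta. Proof. by have := zeta1; lra. Qed.

Lemma rho_gt0 : 0 < rho. Proof. exact: divr_gt0. Qed.
Lemma rho_lt1 : rho < 1. Proof. by rewrite /rho_mu ltr_pdivrMr// mul1r. Qed.
Lemma rhoz_gt0 : 0 < rho * zeta. Proof. by rewrite mulr_gt0// rho_gt0. Qed.
Lemma rhoz_lt1 : rho * zeta < 1.
Proof. by rewrite /rho_mu mulrAC ltr_pdivrMr// mul1r. Qed.

Lemma pi_mu_ge0 i : 0 <= pi_mu m i.
Proof.
rewrite mulr_ge0 ?exprn_ge0 ?(ltW rho_gt0)//.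
by have := rho_lt1; lra.
Qed.

(** Since [rho_mu * zeta < 1], such functions are summable against [pi_mu]; [pi_mean] below is a
    mere [limn] and is meaningful on this class. *)
Definition geom_bounded (C : R) (f : nat -> R) := forall i, `|f i| <= C * zeta ^+ i.

Definition pi_mean (f : nat -> R) : R := limn (series (fun i => pi_mu m i * f i)).

Lemma geom_bounded_ge0 C f : geom_bounded C f -> 0 <= C.
Proof. by move/(_ 0%N); rewrite expr0 mulr1; apply: le_trans. Qed.

Lemma geom_boundedD C D f g :
  geom_bounded C f -> geom_bounded D g -> geom_bounded (C + D) (fun i => f i + g i).
Proof. by move=> hf hg i; rewrite mulrDl (le_trans (ler_normD _ _))// lerD. Qed.

Lemma geom_boundedN C f : geom_bounded C f -> geom_bounded C (fun i => - f i).
Proof. by move=> hf i; rewrite normrN. Qed.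

Lemma geom_bounded_cst c : geom_bounded `|c| (fun=> c).
Proof. by move=> i; rewrite ler_peMr// exprn_ege1// ltW. Qed.

Lemma pi_term_bound C f : geom_bounded C f -> forall i,
  `|pi_mu m i * f i| <= (C * (1 - rho)) * (rho * zeta) ^+ i.
Proof.
move=> hf i; rewrite normrM ger0_norm ?pi_mu_ge0//.
apply: le_trans (ler_wpM2l (pi_mu_ge0 i) (hf i)) _.
by rewrite /pi_mu [(rho * _) ^+ i]exprMn le_eqVlt; apply/orP; left; apply/eqP; ring.
Qed.

Lemma pi_mean_cvg C f : geom_bounded C f ->
  cvgn (series (fun i => pi_mu m i * f i)).
Proof.
move=> hf; apply: normed_cvg.
apply: (@series_le_cvg _ _ (geometric (C * (1 - rho)) (rho * zeta))).
- by move=> i; exact: normr_ge0.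
- move=> i /=; rewrite !mulr_ge0 ?exprn_ge0 ?(geom_bounded_ge0 _ _ hf)//.
    by have := rho_lt1; lra.
  exact: ltW rhoz_gt0.
- by move=> i; exact: pi_term_bound.
- by apply: is_cvg_geometric_series; rewrite gtr0_norm ?rhoz_gt0// rhoz_lt1.
Qed.

(** The terms are dominated by a geometric sequence of ratio [rho * zeta]. Taken at [n = 0] this
    bounds the mean itself; at the cut-off of [s_tilde] it gives the truncation error. *)
Lemma pi_mean_tail C f n : geom_bounded C f ->
  `|pi_mean f - \sum_(0 <= i < n) pi_mu m i * f i|
    <= C * (1 - rho) / (1 - rho * zeta) * (rho * zeta) ^+ n.
Proof.
move=> hf; set u := series (fun i => pi_mu m i * f i).
have C0 := geom_bounded_ge0 _ _ hf.
have rz0 := rhoz_gt0; have rz1 := rhoz_lt1; have r1 := rho_lt1.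
have cu : cvgn u := pi_mean_cvg _ _ hf.
have cv : (fun N => `|u N - u n|) @ \oo --> `|pi_mean f - u n|.
  by apply: cvg_norm; apply: cvgB; [exact: cu|exact: cvg_cst].
rewrite -[X in `|_ - X|]/(u n) -(cvg_lim _ cv)//.
apply: limr_le; first by apply/cvg_ex; eexists; exact: cv.
near=> N; have nN : (n <= N)%N by near: N; exact: nbhs_infty_ge.
rewrite /u sub_series_geq//.
apply: (le_trans (ler_norm_sum _ _ _)).
apply: (@le_trans _ _ (\sum_(n <= k < N) (C * (1 - rho)) * (rho * zeta) ^+ k)).
  by apply: ler_sum => k _; exact: pi_term_bound.
rewrite -mulr_sumr -[leRHS]mulrA ler_wpM2l ?mulr_ge0 ?subr_ge0 ?(ltW r1)//.
rewrite [leRHS]mulrC ler_pdivlMr ?subr_gt0//.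
rewrite -(subnKC nN); elim: (N - n)%N => [|k IH].
  by rewrite addn0 big_geq// mul0r exprn_ge0// ltW.
(* Multiplied by one minus its ratio, the geometric sum telescopes. *)
have : \sum_(n <= i < n + k) (rho * zeta) ^+ i * (1 - rho * zeta) =
    (rho * zeta) ^+ n - (rho * zeta) ^+ (n + k).
  elim: k {IH} => [|k IH]; first by rewrite addn0 big_geq// subrr.
  by rewrite addnS big_nat_recr ?leq_addr//= IH exprS; ring.
rewrite addnS big_nat_recr ?leq_addr//= mulrDl -mulr_suml => ->.
have := exprn_ge0 (n + k).+1 (ltW rz0); rewrite exprS; lra.
Unshelve. all: by end_near. Qed.

Lemma pi_mean_bound C f : geom_bounded C f ->
  `|pi_mean f| <= C * (1 - rho) / (1 - rho * zeta).
Proof. by move/(pi_mean_tail _ _ 0); rewrite big_geq// subr0 expr0 mulr1. Qed.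

Lemma pi_meanD C D f g : geom_bounded C f -> geom_bounded D g ->
  pi_mean (fun i => f i + g i) = pi_mean f + pi_mean g.
Proof.
move=> hf hg; have [cf cg] := (pi_mean_cvg _ _ hf, pi_mean_cvg _ _ hg).
rewrite /pi_mean -limD//.
congr (limn _); apply/funext => n.
rewrite fctE !seriesEnat/= -big_split; apply: eq_bigr => i _.
by rewrite mulrDr.
Qed.

Lemma pi_meanN C f : geom_bounded C f -> pi_mean (fun i => - f i) = - pi_mean f.
Proof.
move=> hf; have cf := pi_mean_cvg _ _ hf; rewrite /pi_mean -limN//.
congr (limn _); apply/funext => n; rewrite fctE !seriesEnat/= -sumrN.
by apply: eq_bigr => i _; rewrite mulrN.
Qed.

Lemma pi_meanB C D f g : geom_bounded C f -> geom_bounded D g ->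
  pi_mean (fun i => f i - g i) = pi_mean f - pi_mean g.
Proof.
move=> hf hg; rewrite (pi_meanD _ _ _ _ hf (geom_boundedN _ _ hg)).
by rewrite (pi_meanN _ _ hg).
Qed.

Lemma pi_mean_cst c : pi_mean (fun=> c) = c.
Proof.
have r1 : `|rho| < 1 by rewrite gtr0_norm ?rho_gt0 ?rho_lt1.
have h := @cvg_geometric_series _ (c * (1 - rho)) rho r1.
rewrite mulfK in h; last by apply/eqP; have := rho_lt1; lra.
rewrite /pi_mean -[RHS](cvg_lim (@Rhausdorff R) h); congr (limn (series _)).
by apply/funext => i; rewrite /pi_mu mulrC mulrA.
Qed.

Lemma pi_mean_le C D f g : geom_bounded C f -> geom_bounded D g ->
  (forall i, f i <= g i) -> pi_mean f <= pi_mean g.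
Proof.
move=> hf hg fg; apply: ler_lim (pi_mean_cvg _ _ hf) (pi_mean_cvg _ _ hg) _.
near=> n; rewrite !seriesEnat/=; apply: ler_sum => i _.
by rewrite ler_wpM2l// pi_mu_ge0.
Unshelve. all: by end_near. Qed.

(** Detailed balance: the stationary flow from [i.+1] down to [i] equals the flow back up. *)
Lemma pi_muS i : mu m * pi_mu m i.+1 = l * pi_mu m i.
Proof. by rewrite /pi_mu exprS {2}/rho_mu; field; exact: lt0r_neq0. Qed.

(** One step climbs at most one level, which costs a factor [zeta]. The growth under iteration is
    harmless: only finiteness of the constant is used. *)
Lemma geom_bounded_walk C f : geom_bounded C f -> geom_bounded (C * zeta) (walk (m := m) f).
Proof.
move=> hf i; have C0 := geom_bounded_ge0 _ _ hf.
have := ind_bounds _ _ i (service_rate_bounds _ (mu_in m)).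
have b0 := beta_gt0 m.
rewrite /walk; set a := mu m * _ => /andP[a0 a1].
have hz : C * zeta ^+ i <= C * zeta * zeta ^+ i.
  by rewrite -mulrA ler_wpM2l// ler_peMl ?exprn_ge0// ltW.
apply: le_trans (ler_norm_comb3 _ _ _ _ _ _ (C * zeta * zeta ^+ i) (C * zeta * zeta ^+ i)
   (C * zeta * zeta ^+ i) _ _ _ _ _ _) _ => //.
- exact: ltW.
- lra.
- by rewrite (le_trans (hf _))// exprS mulrA.
- rewrite (le_trans (hf _))//; apply: le_trans hz; rewrite ler_wpM2l//.
  by rewrite ler_weXn2l ?leq_pred// ltW.
- exact: le_trans (hf _) hz.
- by rewrite le_eqVlt; apply/orP; left; apply/eqP; ring.
Qed.

Lemma geom_bounded_iter_walk C f n : geom_bounded C f ->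
  geom_bounded (C * zeta ^+ n) (iter n (walk (m := m)) f).
Proof.
move=> hf; elim: n => [|n IH]; first by rewrite expr0 mulr1.
by rewrite exprSr mulrA; exact: geom_bounded_walk.
Qed.

(* Detailed balance turns the partial sums into a single flux term. *)
Lemma pi_walk_flux f n :
  \sum_(0 <= i < n.+1) pi_mu m i * walk (m := m) f i =
  \sum_(0 <= i < n.+1) pi_mu m i * f i + l * pi_mu m n * (f n.+1 - f n).
Proof.
elim: n => [|n IH]; first by rewrite !big_nat1 /walk/=; ring.
rewrite big_nat_recr//= IH [in RHS]big_nat_recr//= /walk/=.
have := pi_muS n; move: (\sum_(_ <= _ < _) _) => S e.
have -> : pi_mu m n.+1 * (l * f n.+2 + mu m * 1 * f n + (1 - l - mu m * 1) * f n.+1)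
  = pi_mu m n.+1 * (l * f n.+2 + (1 - l) * f n.+1) + mu m * pi_mu m n.+1 * (f n - f n.+1) by ring.
by rewrite e; ring.
Qed.

(** The partial sums of the two means differ by the flux at the last index, and both the flux and
    the two tails decay like [(rho * zeta) ^+ n]. *)
Lemma pi_mean_walk C f : geom_bounded C f -> pi_mean (walk (m := m) f) = pi_mean f.
Proof.
move=> hf; have hQ := geom_bounded_walk _ _ hf.
have C0 := geom_bounded_ge0 _ _ hf.
have rz0 := rhoz_gt0; have rz1 := rhoz_lt1; have r1 := rho_lt1.
apply/eqP; rewrite -subr_eq0 -normr_le0.
set q := rho * zeta in rz0 rz1.
(* The constants of the two tails after [n.+1] terms, hence the factor [q], plus that of the
   flux. *)
pose K : R := (C * zeta * (1 - rho) / (1 - q) + C * (1 - rho) / (1 - q)) * q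
  + l * (C * zeta + C) * (1 - rho).
apply: (@le_geometric0 _ K q); first by rewrite (ltW rz0).
move=> n; have h1 := pi_mean_tail _ _ n.+1 hQ; have h2 := pi_mean_tail _ _ n.+1 hf.
have h3 : `|l * pi_mu m n * (f n.+1 - f n)| <= l * (C * zeta + C) * (1 - rho) * q ^+ n.
  have -> : l * pi_mu m n * (f n.+1 - f n) = l * (pi_mu m n * (f n.+1 - f n)) by ring.
  rewrite normrM (gtr0_norm l0).
  have -> : l * (C * zeta + C) * (1 - rho) * q ^+ n = l * ((C * zeta + C) * (1 - rho) * q ^+ n) by ring.
  rewrite ler_wpM2l ?(ltW l0)//.
  have hD : geom_bounded (C * zeta + C) (fun i => f i.+1 - f i).
    apply: geom_boundedD (geom_boundedN _ _ hf) => i.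
    by rewrite (le_trans (hf _))// exprS mulrA.
  exact: (pi_term_bound _ _ hD n).
move: h1 h2; rewrite pi_walk_flux -/q exprS.
move: (\sum_(_ <= _ < _) _) h3 => S; rewrite /K.
move: (pi_mean _) (pi_mean _) (l * pi_mu m n * _) => x y z.
rewrite !ler_norml => /andP[? ?] /andP[? ?] /andP[? ?]; apply/andP; split; lra.
Qed.

Lemma pi_mean_iter_walk C f n : geom_bounded C f ->
  pi_mean (iter n (walk (m := m)) f) = pi_mean f.
Proof.
move=> hf; elim: n => //= n <-.
exact: pi_mean_walk (geom_bounded_iter_walk _ _ n hf).
Qed.

(** The eigenvalue of the interior walk on [zeta ^ i]; [1 - kappa] factors as
    [(zeta - 1) * (mu - lambda * zeta) / zeta], which is positive for [zeta] strictly between 1 and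
    [mu / lambda]. *)
Let kappa := l * zeta + mu m / zeta + 1 - l - mu m.

Lemma kappa_bounds : 0 <= kappa < 1.
Proof.
have /andP[_ h] := service_rate_bounds _ (mu_in m); have b0 := beta_gt0 m.
have h1 : 0 < l * zeta by rewrite mulr_gt0.
have h2 : 0 < mu m / zeta by rewrite divr_gt0.
rewrite /kappa; apply/andP; split; first lra.
rewrite -subr_gt0.
have -> : 1 - (l * zeta + mu m / zeta + 1 - l - mu m) = (zeta - 1) * (mu m - l * zeta) / zeta.
  by field; exact: lt0r_neq0.
by rewrite divr_gt0// mulr_gt0// subr_gt0.
Qed.

(* The increments of [f] evolve under the walk killed at the boundary, for
   which the weight [zeta ^ i] contracts. *)
Lemma walk_diff C f : 0 <= C -> (forall i, `|f i.+1 - f i| <= C * zeta ^+ i) ->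
  forall i, `|walk (m := m) f i.+1 - walk (m := m) f i| <= kappa * C * zeta ^+ i.
Proof.
move=> C0 hf i.
have /andP[_ hmu] := service_rate_bounds _ (mu_in m); have b0 := beta_gt0 m.
have mz : 0 <= mu m / zeta by rewrite divr_ge0// ltW.
case: i => [|i]; rewrite /walk/=.
  (* At the boundary the increment has no downward neighbour: the mass [mu] is lost. The summand
     [0 * 0] keeps the three-term shape. *)
  have -> : l * f 2%N + mu m * 1 * f 0%N + (1 - l - mu m * 1) * f 1%N
     - (l * f 1%N + mu m * 0 * f 0%N + (1 - l - mu m * 0) * f 0%N)
     = l * (f 2%N - f 1%N) + 0 * 0 + (1 - l - mu m) * (f 1%N - f 0%N) by ring.
  apply: le_trans (ler_norm_comb3 _ _ _ _ _ _ _ 0 _ _ _ _ (hf 1%N) _ (hf 0%N)) _ => //.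
  - exact: ltW.
  - lra.
  - by rewrite normr0.
  - rewrite expr1 expr0 /kappa.
    have := mulr_ge0 mz C0; move: (mu m / zeta) => M h; nra.
have -> : l * f i.+3 + mu m * 1 * f i.+1 + (1 - l - mu m * 1) * f i.+2
     - (l * f i.+2 + mu m * 1 * f i + (1 - l - mu m * 1) * f i.+1)
     = l * (f i.+3 - f i.+2) + mu m * (f i.+1 - f i) + (1 - l - mu m) * (f i.+2 - f i.+1) by ring.
apply: le_trans (ler_norm_comb3 _ _ _ _ _ _ _ _ _ _ _ _ (hf _) (hf _) (hf _)) _ => //.
- exact: ltW.
- exact: ltW.
- lra.
- rewrite le_eqVlt; apply/orP; left; apply/eqP; rewrite /kappa !exprS; field.
  exact: lt0r_neq0.
Qed.

(** Increments shrink like [kappa ^+ n]; summing them bounds the distance of the iterate to its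
    value at 0. Averaging over the invariant [pi_mu] shows that this value is itself close to
    [pi_mean f]. *)
Lemma walk_ergodic C f : geom_bounded C f ->
  exists2 D, 0 <= D &
    forall n i, `|iter n (walk (m := m)) f i - pi_mean f| <= D * kappa ^+ n * zeta ^+ i.
Proof.
move=> hf; have C0 := geom_bounded_ge0 _ _ hf.
have /andP[k0 k1] := kappa_bounds.
have rz0 := rhoz_gt0; have rz1 := rhoz_lt1; have r1 := rho_lt1.
pose E : R := C * (zeta + 1).
have E0 : 0 <= E by rewrite mulr_ge0//; have := z0; lra.
have dE n i : `|iter n (walk (m := m)) f i.+1 - iter n (walk (m := m)) f i|
    <= kappa ^+ n * E * zeta ^+ i.
  elim: n i => [|n IH] i.
    rewrite expr0 mul1r /= (le_trans (ler_normB _ _))//.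
    rewrite (le_trans (lerD (hf _) (hf _)))// exprS /E le_eqVlt; apply/orP; left; apply/eqP; ring.
  rewrite exprS -(mulrA kappa); apply: walk_diff => //.
  by rewrite mulr_ge0// exprn_ge0.
(* Summing the increments below [i] gives at most [E * zeta ^+ i / (zeta - 1)]. *)
pose F : R := E / (zeta - 1).
have F0 : 0 <= F by rewrite divr_ge0//; have := zeta1; lra.
have hF n i : `|iter n (walk (m := m)) f i - iter n (walk (m := m)) f 0%N|
    <= F * kappa ^+ n * zeta ^+ i.
  elim: i => [|i IH].
    by rewrite subrr normr0 expr0 mulr1 mulr_ge0 ?exprn_ge0.
  rewrite -(subrKA (iter n (walk (m := m)) f i) (iter n (walk (m := m)) f i.+1)).
  apply: le_trans (ler_normD _ _) _; apply: le_trans (lerD (dE n i) IH) _.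
  rewrite le_eqVlt; apply/orP; left; apply/eqP; rewrite exprS /F; field.
  by apply/eqP; have := zeta1; lra.
clearbody F.
exists (F + F * (1 - rho) / (1 - rho * zeta)).
  by rewrite addr_ge0// divr_ge0 ?mulr_ge0 ?subr_ge0 ?(ltW r1) ?(ltW rz1).
move=> n i.
have hn := geom_bounded_iter_walk _ _ n hf.
have hb : geom_bounded (F * kappa ^+ n)
   (fun i => iter n (walk (m := m)) f i - iter n (walk (m := m)) f 0%N) by move=> j; exact: hF.
have := pi_mean_bound _ _ hb.
rewrite (pi_meanB _ _ _ _ hn (geom_bounded_cst _)) pi_mean_cst (pi_mean_iter_walk _ _ _ hf).
move=> h2; have h1 := hF n i.
have -> : iter n (walk (m := m)) f i - pi_mean f =
  (iter n (walk (m := m)) f i - iter n (walk (m := m)) f 0%N) -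
  (pi_mean f - iter n (walk (m := m)) f 0%N) by ring.
apply: le_trans (ler_normB _ _) _; rewrite !mulrDl; apply: lerD; first exact: h1.
apply: le_trans h2 _.
have -> : F * kappa ^+ n * (1 - rho) / (1 - rho * zeta) =
  F * (1 - rho) / (1 - rho * zeta) * kappa ^+ n by rewrite -!(mulrA F); congr (F * _); ring.
rewrite ler_peMr ?exprn_ege1 ?(ltW zeta1)// mulr_ge0 ?exprn_ge0//.
by rewrite divr_ge0 ?mulr_ge0 ?subr_ge0 ?(ltW r1) ?(ltW rz1).
Qed.

Hypothesis zetabeta : l * zeta < l + beta m.

(** Mass [beta] falls to the other level, and of the rest only the arrivals increase the weight.
    Service moves down, so bounding its target by the weight at [i] makes the rate chosen by [phi]
    cancel. *)
Lemma step_true_bound phi f B W i : 0 <= B ->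
  (forall i, `|f (i, true)| <= B * zeta ^+ i) ->
  `|f (i, false)| <= W * zeta ^+ i ->
  `|step (m := m) phi f (i, true)| <=
    ((l * zeta + 1 - l - beta m) * B + beta m * W) * zeta ^+ i.
Proof.
move=> B0 hB hW; have := ind_bounds _ _ i (rate_bounds phi (i, true)).
have b0 := beta_gt0 m.
rewrite /step/=; set a := phi _ * _ => /andP[a0 a1].
apply: le_trans (ler_norm_comb4 _ _ _ _ _ _ _ _ _ _ (B * zeta ^+ i) _ _ _ _ _ (hB _) hW _ (hB _)) _.
- exact: ltW.
- exact: ltW.
- by [].
- lra.
- rewrite (le_trans (hB _))// ler_wpM2l// ler_weXn2l ?leq_pred//; exact: ltW.
- rewrite exprS le_eqVlt; apply/orP; left; apply/eqP; ring.
Qed.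

(** On the controlled level the deviation satisfies a recursion with factor [r < 1], driven by
    [beta] times the deviation on the uncontrolled level, which [walk_ergodic] controls. *)
Lemma step_ergodic phi C (f : state -> R) : (forall x, `|f x| <= C * zeta ^+ x.1) ->
  exists2 D, 0 <= D & exists2 theta, 0 <= theta < 1 &
    forall n x, `|iter n (step (m := m) phi) f x - pi_mean (fun i => f (i, false))|
      <= D * theta ^+ n * zeta ^+ x.1.
Proof.
pose r : R := l * zeta + 1 - l - beta m.
have r1 : r < 1 by rewrite /r; have := zetabeta; lra.
move=> hf; set p := pi_mean _.
have hf0 : geom_bounded C (fun i => f (i, false)) by move=> i; exact: (hf (i, false)).
have [D0 D00 hD0] := walk_ergodic _ _ hf0.
have C0 := geom_bounded_ge0 _ _ hf0.
have /andP[k0 k1] := kappa_bounds.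
have b0 := beta_gt0 m.
(* Any rate below 1 that is at least [kappa] and strictly above [r] would do; the gap to [r] absorbs
   the driving term even when [kappa = r]. *)
pose theta : R := (1 + Num.max kappa r) / 2.
have [hk hr] : kappa <= Num.max kappa r /\ r <= Num.max kappa r by rewrite !le_max !lexx orbT.
have hm : Num.max kappa r < 1 by rewrite gt_max k1 r1.
have tk : kappa <= theta by rewrite /theta; lra.
have tr : r < theta by rewrite /theta; lra.
have t1 : theta < 1 by rewrite /theta; lra.
have t0 : 0 <= theta by lra.
have Q0 : 0 <= beta m * D0 / (theta - r).
  by rewrite divr_ge0 ?mulr_ge0 ?subr_ge0 ?(ltW tr)// ltW.
(* The summands serve in turn the uncontrolled level, the induction step
   [r * D + beta * D0 <= theta * D], and the case [n = 0]. *)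
pose D : R := D0 + beta m * D0 / (theta - r) + (C + `|p|).
have DD0 : D0 <= D by rewrite /D; have := normr_ge0 p; lra.
have Dge0 : 0 <= D by exact: le_trans DD0.
have DQ : beta m * D0 <= (theta - r) * D.
  rewrite -ler_pdivrMl ?subr_gt0// mulrC /D; have := normr_ge0 p; lra.
exists D => //; exists theta; first by rewrite t0.
have h0 n i : `|iter n (step phi) f (i, false) - p| <= D0 * theta ^+ n * zeta ^+ i.
  rewrite iter_step_walk; apply: le_trans (hD0 n i) _.
  rewrite ler_wpM2r ?exprn_ge0 ?(ltW z0)// ler_wpM2l//; exact: lerXn2r.
move=> n [i []]; last first.
  apply: le_trans (h0 n i) _.
  by rewrite ler_wpM2r ?exprn_ge0 ?(ltW z0)// ler_wpM2r// exprn_ge0.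
elim: n i => [|n IH] i.
  rewrite /= expr0 mulr1.
  have hb := geom_boundedD _ _ _ _ (fun j => hf (j, true)) (geom_boundedN _ _ (geom_bounded_cst p)).
  apply: le_trans (hb i) _; rewrite ler_wpM2r ?exprn_ge0 ?(ltW z0)//.
  rewrite /D; lra.
rewrite iterS -stepBC.
apply: le_trans (step_true_bound _ _ (D * theta ^+ n) (D0 * theta ^+ n) _ _ _ _) _.
- by rewrite mulr_ge0// exprn_ge0.
- exact: IH.
- exact: h0.
rewrite -/r ler_wpM2r ?exprn_ge0 ?(ltW z0)//.
have -> : r * (D * theta ^+ n) + beta m * (D0 * theta ^+ n) =
   (r * D + beta m * D0) * theta ^+ n by ring.
have -> : D * theta ^+ n.+1 = theta * D * theta ^+ n by rewrite exprS; ring.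
rewrite ler_wpM2r ?exprn_ge0//; lra.
Qed.

End geometric_bound.

(** * Sums against the transition probabilities, and powers at a rounded logarithm *)

Lemma sum_pt {R : pzRingType} {T : eqType} (r : seq T) (z : T) (c : R) (f : T -> R) :
  uniq r -> z \in r -> \sum_(y <- r) c * (y == z)%:R * f y = c * f z.
Proof.
move=> ur zr; rewrite (bigD1_seq z)//= eqxx mulr1 big1 ?addr0// => y /negbTE ->.
by rewrite mulr0 mul0r.
Qed.

Lemma fsum_trans {R : realType} {m : model R} (phi : policy m) x (f : state -> R) :
  \sum_(y \in [set: state]) trans phi x y * f y = step phi f x.
Proof.
case: x => i b.
(* The possible successors coincide in places: [i.-1] is [i] at the boundary, and [(i, false)] is
   [(i, b)] on the uncontrolled level. Hence [undup]. *)
pose r : seq state := undup [:: (i.+1, b); (i.-1, b); (i, false); (i, b)].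
rewrite (fsbigE r) ?undup_uniq//; last first.
  move=> y _; rewrite mem_undup !inE !negb_or =>
    /and4P[/negbTE h1 /negbTE h2 /negbTE h3 /negbTE h4].
  by rewrite /trans; case: b h1 h2 h3 h4 {r} => /= h1 h2 h3 h4;
    rewrite h1 h2 h4 ?h3 !mulr0 !addr0 mul0r.
rewrite (eq_bigl xpredT); last by move=> y; rewrite in_setT.
have ur : uniq r := undup_uniq _.
have [r1 r2 r3 r4] : [/\ (i.+1, b) \in r, (i.-1, b) \in r, (i, false) \in r & (i, b) \in r].
  by split; rewrite /r mem_undup !inE eqxx ?orbT.
rewrite /trans /step; case: b @r ur r1 r2 r3 r4 => r ur r1 r2 r3 r4 /=.
  under eq_bigr do rewrite !mulrDl.
  by rewrite !big_split/= !sum_pt//; ring.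
under eq_bigr do rewrite !mulrDl.
by rewrite !big_split/= !sum_pt//; ring.
Qed.

(** As [ln q < 0], an exponent at or above the logarithm suffices. Rounding up and then replacing a
    negative integer by 0 both only increase the exponent. *)
Lemma expr_ceil_log_le {R : realType} (q x : R) : 0 < q < 1 -> 0 < x ->
  q ^+ pos_part (Num.ceil (log_base q x)) <= x.
Proof.
move=> /andP[q0 q1] x0; set n := pos_part _.
have : log_base q x <= n%:R.
  apply: le_trans (ceil_ge _) _; rewrite (_ : n%:R = n%:Z%:~R :> R)// ler_int /n.
  by case: (Num.ceil _).
rewrite /log_base ler_ndivrMr; last by rewrite -ln1 ltr_ln// posrE.
by rewrite mulr_natl -lnXn// ler_ln// posrE exprn_gt0.
Qed.

(** * The weight function and the drift condition *)

Section weights.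
Context {R : realType} (m : model R) (zeta : R).
Hypothesis hzeta : admissible_zeta m zeta.

Notation l := (lambda m).
Notation eta := (Defs.eta m zeta).
Notation weight := (Defs.weight zeta).

Lemma mu1_le_mu : mu1 m <= mu m.
Proof. by have := mu1_lt_mu2 m; case: (mu_in m) => ->; lra. Qed.

Lemma zeta_gt0 : 0 < zeta.
Proof. by have := zeta_gt1 hzeta; lra. Qed.

Lemma beta_lt1 : beta m < 1.
Proof.
have := rates_sum1 m; have := lambda_gt0 m; have := mu1_gt0 m; have := mu1_lt_mu2 m.
lra.
Qed.

Lemma discount_bounds : 0 < (1 - beta m) * zeta < 1.
Proof.
have := zeta_lt hzeta; have := beta_lt1; have := zeta_gt0 => z0 b1.
rewrite ltr_pdivlMr ?subr_gt0// => h; rewrite mulr_gt0 ?subr_gt0//.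
by rewrite mulrC h.
Qed.

(** If [mu1 <= lambda], stability of [mu] forces [mu = mu2], so one of the two clauses on [zeta]
    always applies. *)
Lemma zeta_beta : l * zeta < l + beta m.
Proof.
have l0 := lambda_gt0 m.
suff : zeta < 1 + beta m / l.
  by rewrite -(ltr_pM2l l0) mulrDr mulr1 mulrCA divff ?gt_eqF// mulr1.
have [h|h] := ltP l (mu1 m).
  by have := zeta_stable hzeta h; rewrite lt_min => /andP[].
have h2 : l < mu2 m.
  by have := lambda_lt_mu m; case: (mu_in m) => -> //; rewrite ltNge h.
have := @zeta_unstable _ _ _ hzeta; rewrite h h2 => /(_ isT) /=.
by rewrite lt_min => /andP[].
Qed.

Lemma zeta_mu : l * zeta < mu m.
Proof.
have l0 := lambda_gt0 m.
suff : zeta < mu m / l by rewrite ltr_pdivlMr// mulrC.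
have [h|h] := ltP l (mu1 m).
  have := zeta_stable hzeta h; rewrite lt_min => /andP[h1 _].
  by apply: lt_le_trans h1 _; rewrite ler_pM2r ?invr_gt0// mu1_le_mu.
have h2 : l < mu2 m.
  by have := lambda_lt_mu m; case: (mu_in m) => -> //; rewrite ltNge h.
have := @zeta_unstable _ _ _ hzeta; rewrite h h2 => /(_ isT) /=.
by rewrite !lt_min => /andP[_ /andP[]].
Qed.

(** One inequality for each entry of the maximum. The last amounts to positivity of the quadratic
    [b * zeta - lambda * zeta ^+ 2 - mu1], that is, to [zeta] lying strictly between its roots. *)
Lemma eta_lt1 : eta < 1.
Proof.
have l0 := lambda_gt0 m; have b0 := beta_gt0 m; have z0 := zeta_gt0.
have z1 := zeta_gt1 hzeta; have zb := zeta_beta; have zm := zeta_mu.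
have m1 := mu1_gt0 m.
rewrite /Defs.eta -ltrBrDl !gt_max; apply/and3P; split; first by lra.
- rewrite -subr_gt0.
  have -> : 1 - (1 - l + l * zeta) - - ((1 - zeta^-1) * mu m) =
     (zeta - 1) * (mu m - l * zeta) / zeta by field; exact: lt0r_neq0.
  by rewrite divr_gt0// mulr_gt0// subr_gt0.
- rewrite -subr_gt0.
  set b := l + beta m / 2 + mu1 m.
  have -> : 1 - (1 - l + l * zeta) - (- ((1 - zeta^-1) * mu1 m) - beta m / 2) =
     (b * zeta - l * zeta ^+ 2 - mu1 m) / zeta.
    by rewrite /b; field; exact: lt0r_neq0.
  rewrite divr_gt0//.
  have [h|h] := ltP l (mu1 m).
    have := zeta_stable hzeta h; rewrite lt_min => /andP[h1 _].
    rewrite ltr_pdivlMr// in h1.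
    have -> : b * zeta - l * zeta ^+ 2 - mu1 m =
      (zeta - 1) * (mu1 m - zeta * l) + beta m / 2 * zeta by rewrite /b; ring.
    by rewrite addr_gt0 ?mulr_gt0 ?subr_gt0// divr_gt0.
  have h2 : l < mu2 m.
    by have := lambda_lt_mu m; case: (mu_in m) => -> //; rewrite ltNge h.
  have := @zeta_unstable _ _ _ hzeta; rewrite h h2 => /(_ isT) /=.
  rewrite !lt_min -/b => /andP[_ /andP[_]].
  set S := Num.sqrt _; rewrite ltr_pdivlMr; last by rewrite mulr_gt0.
  have disc : 0 <= b ^+ 2 - 4 * l * mu1 m.
    have -> : b ^+ 2 - 4 * l * mu1 m = (l - mu1 m) ^+ 2 + beta m ^+ 2 / 4 + beta m * (l + mu1 m).
      by rewrite /b; field.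
    by rewrite !addr_ge0 ?sqr_ge0 ?divr_ge0 ?mulr_ge0 ?addr_ge0 ?sqr_ge0// ltW.
  have S2 : S ^+ 2 = b ^+ 2 - 4 * l * mu1 m by rewrite sqr_sqrtr.
  have S0 : 0 <= S := sqrtr_ge0 _.
  (* The smaller root [(b - S) / (2 * l)] is below 1, hence below [zeta]; the larger one bounds
     [zeta] by admissibility. *)
  have hb : b - 2 * l < S.
    rewrite ltNge; apply/negP => hS.
    have : S ^+ 2 <= (b - 2 * l) ^+ 2 by rewrite lerXn2r ?nnegrE//; lra.
    rewrite S2.
    have -> : (b - 2 * l) ^+ 2 = b ^+ 2 - 4 * l * mu1 m - 2 * l * beta m by rewrite /b; field.
    have := mulr_gt0 l0 b0; lra.
  move=> hz.
  have e1 : - S < 2 * l * zeta - b.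
    have : l < l * zeta by rewrite ltr_pMr.
    lra.
  have : 0 < (S - (2 * l * zeta - b)) * (S + (2 * l * zeta - b)).
    by rewrite mulr_gt0//; lra.
  have -> : (S - (2 * l * zeta - b)) * (S + (2 * l * zeta - b)) =
     S ^+ 2 - (2 * l * zeta - b) ^+ 2 by ring.
  rewrite S2.
  have -> : b ^+ 2 - 4 * l * mu1 m - (2 * l * zeta - b) ^+ 2 =
    (4 * l) * (b * zeta - l * zeta ^+ 2 - mu1 m) by ring.
  by rewrite pmulr_rgt0// mulr_gt0.
Qed.

Lemma eta_ge : [/\ 1 - l + l * zeta - beta m <= eta,
   1 - l + l * zeta - (1 - zeta^-1) * mu m <= eta &
   1 - l + l * zeta - (1 - zeta^-1) * mu1 m - beta m / 2 <= eta].
Proof.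
split; last rewrite -[leLHS]addrA; by rewrite /Defs.eta lerD2l !le_max !lexx ?orbT.
Qed.

Lemma eta_ge0 : 0 <= eta.
Proof.
have [h _ _] := eta_ge; apply: le_trans h.
have := mulr_gt0 (lambda_gt0 m) zeta_gt0; have := rates_sum1 m.
have := mu1_gt0 m; have := mu1_lt_mu2 m; lra.
Qed.

Lemma weight_gt0 x : 0 < weight x.
Proof. by rewrite /Defs.weight mulr_gt0 ?exprn_gt0 ?zeta_gt0//; case: x.2. Qed.

Lemma weight_le x : weight x <= zeta ^+ x.1.
Proof.
rewrite /Defs.weight; case: x.2; rewrite ?mul1r// ler_piMl//.
  by rewrite exprn_ge0// ltW// zeta_gt0.
by lra.
Qed.

Lemma wnorm_le f (B : R) : (wnorm zeta f <= B%:E)%E -> forall x, `|f x| <= B * weight x.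
Proof.
move=> h x; rewrite -ler_pdivrMr ?weight_gt0// -lee_fin; apply: le_trans h.
by apply: ereal_sup_ubound; exists x.
Qed.

Lemma wnorm_lty f : (wnorm zeta f < +oo)%E ->
  exists2 C : R, 0 <= C & forall x, `|f x| <= C * weight x.
Proof.
have w0 : (0 <= wnorm zeta f)%E.
  apply: (@le_trans _ _ (`|f (0%N, true)| / weight (0%N, true))%:E).
    by rewrite lee_fin divr_ge0// ltW// weight_gt0.
  by apply: ereal_sup_ubound; exists (0%N, true).
case E : (wnorm zeta f) w0 => [r| |] //= w0 _.
by exists r; [rewrite lee_fin in w0|apply: wnorm_le; rewrite E].
Qed.

(* Drift condition for the chain killed when it enters [(0, 0)]. *)
Lemma taboo_step_bound (phi : policy m) B f : 0 <= B -> f (0%N, false) = 0 ->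
  (forall x, `|f x| <= B * weight x) ->
  forall x, `|step phi f x| <= eta * B * weight x.
Proof.
move=> B0 f0 hf x.
have [e1 e2 e3] := eta_ge; have z0 := zeta_gt0; have z1 := zeta_gt1 hzeta.
have l0 := lambda_gt0 m; have b0 := beta_gt0 m; have m10 := mu1_gt0 m.
have hz : zeta^-1 < 1 by rewrite invf_lt1.
have rb := rate_bounds phi x.
(* The drift coefficient at each state. A fall to the uncontrolled level counts [beta / 2], as the
   weight is halved there; the indicators remove the moves into [(0, 0)] from [(0, 1)] and from
   [(0, 0)] itself. *)
have hs : `|step phi f x| <=
  (if x is (i, true) then l * zeta + beta m / 2 * (0 < i)%N%:R
      + phi x * (0 < i)%N%:R / zeta + (1 - l - beta m - phi x * (0 < i)%N%:R)
   else l * zeta + phi x * (0 < x.1)%N%:R / zeta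
        + (1 - l - phi x * (0 < x.1)%N%:R) * (0 < x.1)%N%:R) * B * weight x.
  case: x rb => i [] /= /andP[a0 a1]; case: i => [|i] in a0 a1 *.
  - rewrite /step/= f0 !mulr0 !mul0r !addr0 subr0.
    have := ler_norm_comb3 l 0 (1 - l - beta m) _ 0 _ _ 0 _ (ltW l0) (lexx _)
      _ (hf (1%N, true)) _ (hf (0%N, true)).
    rewrite mulr0 addr0 normr0 => /(_ _ _)/le_trans; apply => //; first lra.
    by rewrite /Defs.weight/= expr1 expr0 le_eqVlt; apply/orP; left; apply/eqP; ring.
  - have := ler_norm_comb4 l (beta m) (phi (i.+1, true)) (1 - l - beta m - phi (i.+1, true))
      _ _ _ _ _ _ _ _ (ltW l0) (ltW b0) a0 _
      (hf (i.+2, true)) (hf (i.+1, false)) (hf (i, true)) (hf (i.+1, true)).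
    rewrite /step/= mulr1 => /(_ _)/le_trans; apply; first lra.
    rewrite /Defs.weight/= !exprS le_eqVlt; apply/orP; left; apply/eqP; field.
    exact: lt0r_neq0.
  - have := ler_norm_comb3 l 0 0 _ 0 0 _ 0 0 (ltW l0) (lexx _) (lexx _) (hf (1%N, false)).
    rewrite /step/= f0 !mulr0 !mul0r !addr0 normr0 => /(_ _ _)/le_trans; apply => //.
    by rewrite /Defs.weight/= expr1 expr0 le_eqVlt; apply/orP; left; apply/eqP; ring.
  - have := ler_norm_comb3 l (phi (i.+1, false)) (1 - l - phi (i.+1, false))
      _ _ _ _ _ _ (ltW l0) a0 _ (hf (i.+2, false)) (hf (i, false)) (hf (i.+1, false)).
    rewrite /step/= !mulr1 => /(_ _)/le_trans; apply; first lra.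
    rewrite /Defs.weight/= !exprS le_eqVlt; apply/orP; left; apply/eqP; field.
    exact: lt0r_neq0.
apply: le_trans hs _; rewrite ler_pM2r ?weight_gt0// ler_wpM2r//.
case: x rb => i [] /andP[a0 a1] /=.
  case: i a0 a1 => [|i] a0 a1 /=; rewrite ?mulr0 ?mulr1 ?mul0r; first lra.
  (* Faster service only improves the drift, so [mu1] is the worst rate. *)
  have : (1 - zeta^-1) * mu1 m <= (1 - zeta^-1) * phi (i.+1, true).
    rewrite ler_wpM2l ?subr_ge0 ?(ltW hz)//.
    by have := mu1_lt_mu2 m; case: (rate1 phi i.+1) => ->; lra.
  lra.
rewrite rate0 in a0 a1 *.
by case: i a0 a1 => [|i] a0 a1 /=; rewrite ?mulr0 ?mulr1 ?mul0r; lra.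
Qed.

End weights.

(** * The optimality equation and value iteration *)

Section value_iteration.
Context {R : realType} {m : model R} {zeta uM : R} {H : state -> R}.
Hypothesis hzeta : admissible_zeta m zeta.
Hypothesis hH : is_Hstar m zeta H.
Hypothesis huM : is_uM m zeta uM.

Notation l := (lambda m).
Notation eta := (Defs.eta m zeta).
Notation weight := (Defs.weight zeta).

Let z0 : 0 < zeta := zeta_gt0 _ _ hzeta.
Let w0 := weight_gt0 _ _ hzeta.

Lemma cost_rate_ge0 (phi : policy m) x : 0 <= cost_rate m (phi x).
Proof.
have h2 := cost_mu2_gt0 m; have h1 := cost_mu1 m.
have : phi x = mu1 m \/ phi x = mu2 m.
  by case: x => i []; [exact: rate1|rewrite rate0; exact: mu_in].
by case=> ->; rewrite ?h1// ltW.
Qed.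

Lemma cost_ge0 (phi : policy m) x : 0 <= cost phi x.
Proof. by rewrite addr_ge0 ?cost_rate_ge0 ?h_ge0. Qed.

Lemma cost_le (phi : policy m) x : cost phi x <= uM * weight x.
Proof.
rewrite -[leLHS]ger0_norm ?cost_ge0//; apply: (wnorm_le _ _ hzeta).
move: huM; rewrite /is_uM ge_max => /andP[h _]; apply: le_trans h.
by apply: ereal_sup_ubound; exists phi.
Qed.

Definition constant_rate (a : R) (ha : a = mu1 m \/ a = mu2 m) : policy m.
Proof.
by exists (fun x => if x.2 then a else mu m).
Defined.

Lemma g_mu_ge0 : 0 <= g_mu m.
Proof.
have r0 := rho_gt0 m; have r1 := rho_lt1 m.
have h := cost_rate_ge0 (constant_rate _ (mu_in m)) (0%N, false).
rewrite /g_mu addr_ge0// mulr_ge0 ?subr_ge0 ?(ltW r1)//.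
apply: limr_ge; first by apply: h_summable; rewrite r0 r1.
near=> n; rewrite seriesEnat/= sumr_ge0// => i _.
by rewrite mulr_ge0 ?h_ge0 ?exprn_ge0// ltW.
Unshelve. all: by end_near. Qed.

Lemma g_mu_le x : g_mu m <= uM * weight x.
Proof.
rewrite -[leLHS]ger0_norm ?g_mu_ge0//; apply: (wnorm_le _ _ hzeta (fun=> g_mu m)).
by move: huM; rewrite /is_uM ge_max => /andP[_ h].
Qed.

(** In the empty controlled state the weight is 1, and serving at [mu2] has positive cost. *)
Lemma uM_gt0 : 0 < uM.
Proof.
have := cost_le (constant_rate _ (or_intror erefl)) (0%N, true).
rewrite /cost/= h0 addr0 /Defs.weight expr0 !mulr1.
exact/lt_le_trans/cost_mu2_gt0.
Qed.

Lemma Hstar_le (phi : policy m) x : g_mu m + H x <= cost phi x + step phi H x.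
Proof.
have [_ /(_ _ _)] := Hstar_opt hH x; apply; exists phi => //.
by rewrite fsum_trans.
Qed.

Lemma Hstar_attained x :
  exists phi : policy m, g_mu m + H x = cost phi x + step phi H x.
Proof.
have [[phi _ <-] _] := Hstar_opt hH x.
by exists phi; rewrite fsum_trans.
Qed.

(** Cost and transitions at [x] depend on a policy only through its rate at [x], so minimisers
    chosen state by state combine along the diagonal. *)
Lemma optimal_policy :
  exists phi : policy m, forall x, g_mu m + H x = cost phi x + step phi H x.
Proof.
have [p hp] := choice Hstar_attained.
unshelve eexists.
- exists (fun x => p x x) => i; [exact: rate1|exact: rate0].
- by move=> x; rewrite hp.
Qed.

(** The optimality equation at a minimising policy reads [H = (cost - g_mu) + step H], and [H]
    vanishes at [(0, 0)], so the drift condition contracts by [eta]. The source is a difference of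
    two nonnegative terms, each at most [uM * weight], so it is bounded by [uM * weight] as well. *)
Lemma Hstar_bound x : `|H x| <= uM / (1 - eta) * weight x.
Proof.
have [C C0 hC] := wnorm_lty _ _ hzeta _ (Hstar_bounded hH).
apply: (contraction_bound _ _ C) => //.
- exact: ltW uM_gt0.
- by rewrite (eta_ge0 _ _ hzeta) (eta_lt1 _ _ hzeta).
move=> B B0 hB {}x; have [phi e] := Hstar_attained x.
have -> : H x = (cost phi x - g_mu m) + step phi H x by lra.
apply: le_trans (ler_normD _ _) _; rewrite mulrDl; apply: lerD.
  have := cost_ge0 phi x; have := cost_le phi x; have := g_mu_ge0; have := g_mu_le x.
  by move=> ? ? ? ?; rewrite ler_norml; apply/andP; split; lra.
exact: (taboo_step_bound _ _ hzeta _ _ _ B0 (Hstar_00 hH) hB).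
Qed.

(** One round of [VI]: a fall to the uncontrolled level is priced by the known [H], leaving total
    mass [1 - beta] on [V]. *)
Definition bellman (V : nat -> R) (i : nat) : R :=
  let Q a :=
    let a' := a * (0 < i)%N%:R in
    cost_rate m a + h m i - g_mu m + beta m * H (i, false)
    + a' * V i.-1 + (1 - beta m - l - a') * V i + l * V i.+1 in
  Num.min (Q (mu1 m)) (Q (mu2 m)).

(** A policy enters the equation at [(i, true)] only through its rate there, and both rates are
    realised by constant policies. *)
Lemma Hstar_bellman i : H (i, true) = bellman (fun j => H (j, true)) i.
Proof.
pose Q a := let a' := a * (0 < i)%N%:R in
  cost_rate m a + h m i - g_mu m + beta m * H (i, false)
    + a' * H (i.-1, true) + (1 - beta m - l - a') * H (i, true) + l * H (i.+1, true).
rewrite -[RHS]/(Num.min (Q (mu1 m)) (Q (mu2 m))).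
have e (phi : policy m) : cost phi (i, true) + step phi H (i, true) = g_mu m + Q (phi (i, true)).
  by rewrite /cost /step /Q/=; ring.
have [phi] := Hstar_attained (i, true); rewrite e => /addrI hphi.
have := Hstar_le (constant_rate _ (or_introl erefl)) (i, true).
have := Hstar_le (constant_rate _ (or_intror erefl)) (i, true).
rewrite !e !lerD2l/= => h2 h1.
by case: (rate1 phi i) hphi => -> hphi; rewrite hphi; [rewrite min_l -?hphi|rewrite min_r -?hphi].
Qed.

Let r : R := (1 - beta m) * zeta.
Let K : R := g_mu m + uM + beta m * uM / (1 - eta).

Let r0 : 0 < r. Proof. by have /andP[] := discount_bounds _ _ hzeta. Qed.
Let r1 : r < 1. Proof. by have /andP[] := discount_bounds _ _ hzeta. Qed.

Let K0 : 0 < K.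
Proof.
have u0 := uM_gt0; have b0 := beta_gt0 m; have e1 := eta_lt1 _ _ hzeta.
rewrite /K ltr_wpDr//; first by rewrite divr_ge0 ?subr_ge0 ?mulr_ge0 ?(ltW e1)// ltW.
by rewrite ltr_wpDl ?g_mu_ge0.
Qed.

(** The minimum is 1-Lipschitz; what remains is mass [1 - beta] on levels up to [i.+1], hence the
    factor [(1 - beta) * zeta]. *)
Lemma bellman_contraction B V W : 0 <= B ->
  (forall i, `|V i - W i| <= B * zeta ^+ i) ->
  forall i, `|bellman V i - bellman W i| <= r * B * zeta ^+ i.
Proof.
move=> B0 hVW i; have z1 := zeta_gt1 hzeta.
have l0 := lambda_gt0 m; have b0 := beta_gt0 m.
have hB j : (j <= i.+1)%N -> `|V j - W j| <= B * zeta ^+ i.+1.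
  move=> ji; apply: le_trans (hVW j) _.
  by rewrite ler_wpM2l// ler_weXn2l// ltW.
suff hQ a : a = mu1 m \/ a = mu2 m ->
  let a' := a * (0 < i)%N%:R in
  `|(cost_rate m a + h m i - g_mu m + beta m * H (i, false)
    + a' * V i.-1 + (1 - beta m - l - a') * V i + l * V i.+1) -
    (cost_rate m a + h m i - g_mu m + beta m * H (i, false)
    + a' * W i.-1 + (1 - beta m - l - a') * W i + l * W i.+1)| <= r * B * zeta ^+ i.
  by apply: ler_dist_min; apply: hQ; [left|right].
move=> ha /=; have /andP[] := ind_bounds _ _ i (service_rate_bounds _ ha).
move: (a * _) => a' a0 a1.
have h1 : (i.-1 <= i.+1)%N by rewrite (leq_trans (leq_pred i)).
have := ler_norm_comb3 _ _ _ _ _ _ _ _ _ a0 _ (ltW l0) (hB _ h1) (hB _ (leqnSn i)) (hB _ (leqnn _)).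
move=> /(_ (1 - beta m - l - a')) hc.
rewrite [X in `|X|](_ : _ = a' * (V i.-1 - W i.-1) + (1 - beta m - l - a') * (V i - W i)
  + l * (V i.+1 - W i.+1)); last by ring.
apply: le_trans (hc _) _; first by lra.
by rewrite exprS /r le_eqVlt; apply/orP; left; apply/eqP; ring.
Qed.

(** The three summands of [K] bound [g_mu], the cost and [beta * H (i, false)]. *)
Lemma bellman0_bound i : `|bellman (fun=> 0) i| <= K * zeta ^+ i.
Proof.
have z1 := zeta_gt1 hzeta; have b0 := beta_gt0 m; have e1 := eta_lt1 _ _ hzeta.
suff hQ a (ha : a = mu1 m \/ a = mu2 m) :
  let a' := a * (0 < i)%N%:R in
  `|(cost_rate m a + h m i - g_mu m + beta m * H (i, false)
    + a' * 0 + (1 - beta m - l - a') * 0 + l * 0) - 0| <= K * zeta ^+ i.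
  rewrite -[X in `|X|]subr0 -[X in _ - X](minxx 0).
  by apply: ler_dist_min; apply: hQ; [left|right].
rewrite /= !mulr0 !addr0 subr0.
have c0 := cost_ge0 (constant_rate a ha) (i, true).
have c1 := cost_le (constant_rate a ha) (i, true).
rewrite /cost /Defs.weight/= mul1r in c0 c1.
have g0 := g_mu_ge0.
have g1 : g_mu m <= g_mu m * zeta ^+ i by rewrite ler_peMr// exprn_ege1// ltW.
have hH1 : `|beta m * H (i, false)| <= beta m * uM / (1 - eta) * zeta ^+ i.
  rewrite normrM gtr0_norm// -!mulrA ler_wpM2l ?(ltW b0)// mulrA.
  apply: le_trans (Hstar_bound _) _; rewrite ler_wpM2l ?(weight_le _ _ hzeta (i, false))//.
  by rewrite divr_ge0 ?subr_ge0 ?(ltW e1)// ltW// uM_gt0.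
apply: le_trans (ler_normD _ _) _; rewrite /K mulrDl; apply: lerD => //.
by rewrite mulrDl ler_norml; apply/andP; split; lra.
Qed.

Lemma VI_error n i : `|H (i, true) - VI m H n i| <= K / (1 - r) * r ^+ n * zeta ^+ i.
Proof.
elim: n i => [|n IH] i.
  rewrite expr0 mulr1 subr0; move: i.
  have [C C0 hC] := wnorm_lty _ _ hzeta _ (Hstar_bounded hH).
  (* [VI] starts at 0, so the initial error is [H (., true)] itself, bounded here as a fixed point
     of [bellman]. *)
  apply: (contraction_bound _ _ C) => //.
  - by move=> i; rewrite exprn_gt0.
  - exact: ltW.
  - by rewrite (ltW r0).
  - by move=> i; have := hC (i, true); rewrite /Defs.weight/= mul1r.
  move=> B B0 hB i; rewrite Hstar_bellman.
  have hB0 j : `|H (j, true) - 0| <= B * zeta ^+ j by rewrite subr0.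
  have h1 := bellman_contraction _ _ _ B0 hB0 i; have h2 := bellman0_bound i.
  rewrite -[X in `|X|](subrK (bellman (fun=> 0) i)).
  by apply: le_trans (ler_normD _ _) _; rewrite mulrDl addrC lerD.
rewrite Hstar_bellman.
have hB : 0 <= K / (1 - r) * r ^+ n.
  by rewrite mulr_ge0 ?divr_ge0 ?subr_ge0 ?exprn_ge0// ltW.
have := bellman_contraction _ _ _ hB IH i.
have -> // : r * (K / (1 - r) * r ^+ n) = K / (1 - r) * r ^+ n.+1.
by rewrite exprS; ring.
Qed.

Lemma H_tilde_error (e : R) (k : int) i : 0 < e -> i%:Z <= k ->
  `|H (i, true) - H_tilde m zeta uM H e k i| <= e.
Proof.
(* An index [i <= k] exists only for [k >= 0], so [zeta ^ k] is a natural power. *)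
move=> e0; case: k => // k; rewrite lez_nat => ik.
rewrite /H_tilde; apply: le_trans (VI_error _ i) _; rewrite /n_tilde -/r -/K.
set x := e * (1 - r) / (K * zeta ^ k).
have x0 : 0 < x by rewrite /x divr_gt0 ?mulr_gt0 ?subr_gt0 ?exprn_gt0.
have hr : 0 < r < 1 by rewrite r0.
have h := expr_ceil_log_le r x hr x0.
have zk : 0 < zeta ^+ k by rewrite exprn_gt0.
have KK : 0 < K / (1 - r) by rewrite divr_gt0 ?subr_gt0.
apply: (@le_trans _ _ (K / (1 - r) * x * zeta ^+ i)).
  by rewrite ler_wpM2r ?exprn_ge0 ?(ltW z0)// ler_wpM2l// ltW.
have -> : K / (1 - r) * x * zeta ^+ i = e * (zeta ^+ i / zeta ^+ k).
  rewrite /x -exprnP; field; rewrite !lt0r_neq0// ?subr_gt0//.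
rewrite ler_piMr ?(ltW e0)// ler_pdivrMr// mul1r ler_weXn2l//.
exact: ltW (zeta_gt1 hzeta).
Qed.

End value_iteration.

(** * The law of a Markov chain *)

Section state_sums.
Context {R : realType}.
Local Open Scope ereal_scope.
Implicit Types a b : state -> \bar R.

(** Summation over the countable state space by queue length; with values in [\bar R], nonnegative
    families need no summability proof. *)
Definition ssum (a : state -> \bar R) : \bar R :=
  \sum_(0 <= i <oo) (a (i, true) + a (i, false)).

Lemma eq_ssum a b : (forall x, a x = b x) -> ssum a = ssum b.
Proof. by move=> ab; apply: eq_eseriesr => i _; rewrite !ab. Qed.

Lemma ssumD a b : (forall x, 0 <= a x) -> (forall x, 0 <= b x) ->
  ssum (fun x => a x + b x) = ssum a + ssum b.
Proof.
move=> a0 b0; rewrite /ssum -nneseriesD => [|i _ _|i _ _]; try exact: adde_ge0.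
by apply: eq_eseriesr => i _; rewrite addeACA.
Qed.

Lemma ssumZl (c : R) a : (forall x, 0 <= a x) ->
  ssum (fun x => c%:E * a x) = c%:E * ssum a.
Proof.
move=> a0; rewrite /ssum -nneseriesZl => [|i _]; last exact: adde_ge0.
by apply: eq_eseriesr => i _; rewrite ge0_muleDr.
Qed.

Lemma ssum_pt (z : state) (c : R) : ssum (fun x => (c * (x == z)%:R)%:E) = c%:E.
Proof.
case: z => j b; rewrite /ssum; apply: lim_near_cst => //.
near=> n; have jn : (j < n)%N by near: n; exact: nbhs_infty_gt.
rewrite (@big_nat_widenl _ _ _ 0 0)// (bigD1_seq j) ?mem_index_iota ?iota_uniq//=.
rewrite big1 => [|i /negbTE ij]; last by rewrite !xpair_eqE ij !mulr0 adde0.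
rewrite !xpair_eqE !eqxx adde0; case: b => /=;
by rewrite !mulr0 !mulr1 ?adde0 ?add0e.
Unshelve. all: by end_near. Qed.

End state_sums.

Lemma trans_ge0 {R : realType} {m : model R} (phi : policy m) x y :
  0 <= trans phi x y.
Proof.
have l0 := ltW (lambda_gt0 m); have b0 := ltW (beta_gt0 m).
have /andP[a0 a1] := ind_bounds _ _ x.1 (rate_bounds phi x).
by rewrite /trans; case: ifP => _; rewrite !addr_ge0// mulr_ge0//; lra.
Qed.

Lemma step_ge0 {R : realType} {m : model R} (phi : policy m) (f : state -> R) :
  (forall x, 0 <= f x) -> forall x, 0 <= step phi f x.
Proof.
move=> f0 x; have := step_le phi (fun=> 0) f f0 x.
by apply: le_trans; case: x => i []; rewrite /step/= !mulr0 !addr0.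
Qed.

Lemma ssum_trans {R : realType} {m : model R} (phi : policy m) x (f : state -> R) :
  (forall y, 0 <= f y) ->
  ssum (fun y => (f y * trans phi x y)%:E) = (step phi f x)%:E.
Proof.
move=> f0.
have pt (c : R) z : (0 <= c) ->
  (forall y, (0 <= (c * f z * (y == z)%:R)%:E)%E) /\
  ssum (fun y => (c * f z * (y == z)%:R)%:E) = (c * f z)%:E.
  move=> c0; split; last exact: ssum_pt.
  by move=> y; rewrite lee_fin !mulr_ge0.
have l0 := ltW (lambda_gt0 m); have b0 := ltW (beta_gt0 m).
have e (c : R) y z : f y * (c * (y == z)%:R) = c * f z * (y == z)%:R.
  by case: (eqVneq y z) => [->|_]; rewrite ?mulr0// !mulr1 mulrC.
have /andP[a0 a1] := ind_bounds _ _ x.1 (rate_bounds phi x).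
have a2 : 0 <= 1 - lambda m - beta m - phi x * (0 < x.1)%N%:R by lra.
have a3 : 0 <= 1 - lambda m - phi x * (0 < x.1)%N%:R by lra.
rewrite /step; case: x a0 a1 a2 a3 => i [] /= a0 a1 a2 a3.
  have [p1 s1] := pt _ (i.+1, true) l0; have [p2 s2] := pt _ (i, false) b0.
  have [p3 s3] := pt _ (i.-1, true) a0; have [p4 s4] := pt _ (i, true) a2.
  rewrite !EFinD -s1 -s2 -s3 -s4 -!ssumD; try by move=> y; rewrite ?adde_ge0.
  by apply: eq_ssum => y; rewrite /trans/= -!EFinD !mulrDr !e.
have [p1 s1] := pt _ (i.+1, false) l0.
have [p3 s3] := pt _ (i.-1, false) a0; have [p4 s4] := pt _ (i, false) a3.
rewrite !EFinD -s1 -s3 -s4 -!ssumD; try by move=> y; rewrite ?adde_ge0.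
by apply: eq_ssum => y; rewrite /trans/= -!EFinD !mulrDr !e.
Qed.

(** Every set of states is a countable union of rectangles over single queue lengths. *)
Lemma measurable_state (A : set state) : measurable A.
Proof.
have -> : A = \bigcup_i ([set i] `*` [set b | A (i, b)]).
  apply/seteqP; split => [[i b] Aib|[i b] [j _ [/= -> //]]].
  by exists i.
by apply: bigcupT_measurable => i; apply: measurableX.
Qed.

Lemma measurable_fun_state {R : realType} (f : state -> R) : measurable_fun setT f.
Proof. by move=> _ Y mY; exact: measurable_state. Qed.

Section markov.
Context {R : realType} {m : model R} {d : measure_display} {Omega : measurableType d}.
Context {P : probability Omega R}.
Local Open Scope ereal_scope.

Let mX (X : {RV P >-> state}) (A : set state) : measurable (X @^-1` A).
Proof. by apply: measurable_funPTI; exact: measurable_state. Qed.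

Lemma measurable_EFin_state (X : {RV P >-> state}) (f : state -> R) :
  measurable_fun setT (fun w => (f (X w))%:E).
Proof.
apply/measurable_EFinP/measurableT_comp; first exact: measurable_fun_state.
exact: measurable_funP.
Qed.

Lemma integral_state_partition (X : {RV P >-> state}) (A : set Omega) (F : Omega -> \bar R) :
  measurable A -> measurable_fun setT F -> (forall w, 0 <= F w) ->
  \int[P]_(w in A) F w = ssum (fun x => \int[P]_(w in A `&` X @^-1` [set x]) F w).
Proof.
move=> mA mF F0.
pose B i := A `&` X @^-1` [set x | x.1 = i].
have -> : A = \bigcup_i B i.
  by apply/seteqP; split => [w Aw|w [i _ []//]]; exists (X w).1.
rewrite ge0_integral_bigcup//; last 3 first.
- by move=> i; apply: measurableI.
- by apply: measurable_funTS.
- move=> i j _ _ [w [[_ /= <-] [_ /= <-]]] //.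
apply: eq_eseriesr => i _.
have -> : \bigcup_i B i = A.
  by apply/seteqP; split => [w [k _ []//]|w Aw]; exists (X w).1.
have -> : B i = (A `&` X @^-1` [set (i, true)]) `|` (A `&` X @^-1` [set (i, false)]).
  rewrite -setIUr /B; congr (_ `&` _); apply/seteqP; split => w /=.
    by case: (X w) => j [] /= ->; [left|right].
  by case=> ->.
rewrite ge0_integral_setU//.
- by apply: measurableI.
- by apply: measurableI.
- exact: measurable_funTS.
- by apply/disj_setPS => w [[_ /= e1] [_ /= e2]]; rewrite e1 in e2.
Qed.

Lemma measure_state_partition (X : {RV P >-> state}) (A : set Omega) :
  measurable A -> P A = ssum (fun x => P (A `&` X @^-1` [set x])).
Proof.
move=> mA; have := @integral_state_partition X A (cst 1) mA.
rewrite integral_cst// mul1e => -> //.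
apply: eq_ssum => x; rewrite integral_cst ?mul1e//.
exact: measurableI.
Qed.

Lemma integral_state (X : {RV P >-> state}) (A : set Omega) (f : state -> R) :
  measurable A -> (forall x, (0 <= f x)%R) ->
  \int[P]_(w in A) (f (X w))%:E = ssum (fun x => (f x)%:E * P (A `&` X @^-1` [set x])).
Proof.
move=> mA f0; rewrite (integral_state_partition X)//; last 2 first.
- exact: measurable_EFin_state.
- by move=> w; rewrite lee_fin.
apply: eq_ssum => x; rewrite -integral_cst; last exact: measurableI.
by apply: eq_integral => w; rewrite inE => -[_ /= ->].
Qed.

Variables (phi : policy m) (X : nat -> {RV P >-> state}).
Hypothesis mkX : markov_chain phi X.

(** The event that the trajectory follows [s] on the time window from [j] to [n]; the case [j = 0]
    is the one in [markov_chain]. *)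
Let path j n (s : nat -> state) := [set w | forall k, (j <= k <= n)%N -> X k w = s k].

Let mpath j n s : measurable (path j n s).
Proof.
have -> : path j n s = \bigcap_k (if (j <= k <= n)%N then X k @^-1` [set s k] else setT).
  apply/seteqP; split => [w h k _|w h k jkn].
    by case: ifPn => // jk; exact: h.
  by have := h k I; rewrite jkn.
by apply: bigcapT_measurable => k; case: ifP.
Qed.

(* Summing over the state at time [j] forgets the past up to time [j]. *)
Lemma markov_path j n s : (j <= n)%N ->
  P (path j n.+1 s) = P (path j n s) * (trans phi (s n) (s n.+1))%:E.
Proof.
elim: j s => [|j IH] s jn; first exact: mkX.
pose u z k := if k == j then z else s k.
have split_path n' z : (j <= n')%N -> path j.+1 n' s `&` X j @^-1` [set z] = path j n' (u z).
  move=> jn'; apply/seteqP; split => [w [h /= hz] k /andP[jk kn]|w h].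
    rewrite /u; case: eqP => [->//|/eqP kj]; apply: h.
    by rewrite kn andbT ltn_neqAle eq_sym kj.
  split => [k /andP[jk kn]|/=].
    have := h k; rewrite (ltnW jk) kn => /(_ isT) ->.
    by rewrite /u gtn_eqF.
  by have := h j; rewrite leqnn jn' => /(_ isT) ->; rewrite /u eqxx.
rewrite (measure_state_partition (X j) _ (mpath _ _ _)).
rewrite (measure_state_partition (X j) _ (mpath _ n _)).
rewrite muleC -ssumZl; last by move=> z; exact: measure_ge0.
apply: eq_ssum => z; rewrite !split_path ?(ltnW jn)//; last by rewrite ltnW// ltnW.
rewrite IH ?(ltnW jn)// muleC /u !gtn_eqF//.
by rewrite ltnW.
Qed.

Lemma markov_pair n x y :
  P (X n @^-1` [set x] `&` X n.+1 @^-1` [set y]) =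
  P (X n @^-1` [set x]) * (trans phi x y)%:E.
Proof.
pose s k := if k == n then x else y.
have := markov_path _ _ s (leqnn n).
have -> : path n n.+1 s = X n @^-1` [set x] `&` X n.+1 @^-1` [set y].
  apply/seteqP; split => [w h|w [h1 h2] k /andP[nk]].
    split; rewrite /=.
      by have := h n; rewrite leqnn leqnSn => /(_ isT) ->; rewrite /s eqxx.
    by have := h n.+1; rewrite leqnn leqnSn => /(_ isT) ->; rewrite /s gtn_eqF.
  rewrite leq_eqVlt => /orP[/eqP ->|kn]; first by rewrite /s gtn_eqF.
  have -> : k = n by apply/eqP; rewrite eqn_leq nk andbT.
  by rewrite /s eqxx.
have -> : path n n s = X n @^-1` [set x].
  apply/seteqP; split => [w h|w h k].
    by have := h n; rewrite leqnn => /(_ isT) /= ->; rewrite /s eqxx.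
  by rewrite andbC -eqn_leq => /eqP ->; rewrite /s eqxx.
by rewrite /s eqxx gtn_eqF.
Qed.

(** Split according to the states at times [n] and [n.+1]: [markov_pair] factors the joint
    probability and [ssum_trans] resums over the later state. *)
Lemma markov_integralS f n : (forall x, (0 <= f x)%R) ->
  \int[P]_w (f (X n.+1 w))%:E = \int[P]_w (step phi f (X n w))%:E.
Proof.
move=> f0.
have sf0 := step_ge0 phi f f0.
rewrite [RHS]integral_state// (integral_state_partition (X n))//; last 2 first.
- exact: measurable_EFin_state.
- by move=> w; rewrite lee_fin.
apply: eq_ssum => x; rewrite setTI integral_state//.
have Pfin : P (X n @^-1` [set x]) \is a fin_num by exact: fin_num_measure.
rewrite -ssum_trans// -(fineK Pfin) muleC -ssumZl.
  by apply: eq_ssum => y; rewrite markov_pair -(fineK Pfin) -!EFinM; congr EFin; ring.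
by move=> y; rewrite lee_fin mulr_ge0 ?trans_ge0.
Qed.

Lemma markov_integral f n : (forall x, (0 <= f x)%R) ->
  \int[P]_w (f (X n w))%:E = \int[P]_w (iter n (step phi) f (X 0%N w))%:E.
Proof.
elim: n f => // n IH f f0; rewrite markov_integralS// IH ?iterSr// => x.
exact: step_ge0.
Qed.

End markov.

(** * Index ranges bounded by a possibly negative integer *)

Lemma leq_pos_partD1 (k : int) : (pos_part k <= pos_part (k + 1))%N.
Proof.
case: k => // j.
by rewrite (_ : Posz j + 1 = Posz j.+1)/= ?leqnSn// -addn1 PoszD.
Qed.

Lemma ltn_pos_partD1 (i : nat) (k : int) : (i < pos_part (k + 1))%N -> i%:Z <= k.
Proof.
case: k => [j|[|j]] //.
by rewrite (_ : Posz j + 1 = Posz j.+1) ?lez_nat// -addn1 PoszD.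
Qed.

(** * The saved cost *)

Section saved_cost.
Context {R : realType} {m : model R} {zeta uM : R} {H : state -> R}.
Hypothesis hzeta : admissible_zeta m zeta.
Hypothesis hH : is_Hstar m zeta H.
Hypothesis huM : is_uM m zeta uM.

Notation rho := (rho_mu m).
Notation mean := (pi_mean m).
Notation eta := (Defs.eta m zeta).

Let z1 := zeta_gt1 hzeta.
Let zmu := zeta_mu _ _ hzeta.
Let z0 : 0 < zeta := zeta_gt0 _ _ hzeta.

Definition state_bounded (C : R) (f : state -> R) := forall x, `|f x| <= C * zeta ^+ x.1.

Lemma geom_bounded_state C f b : state_bounded C f -> geom_bounded zeta C (fun i => f (i, b)).
Proof. by move=> hf i; exact: (hf (i, b)). Qed.

Lemma state_bounded_iter (phi : policy m) C f : state_bounded C f ->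
  forall n, exists D, state_bounded D (iter n (step phi) f).
Proof.
move=> hf n.
have [D D0 [t t01 hD]] := step_ergodic _ _ z1 zmu (zeta_beta _ _ hzeta) phi _ _ hf.
set p := mean _ in hD.
exists (D * t ^+ n + `|p|) => x.
rewrite -[iter _ _ _ _](subrK p) mulrDl (le_trans (ler_normD _ _))// lerD//.
by rewrite ler_peMr// exprn_ege1// ltW.
Qed.

Lemma state_bounded_cost phi : state_bounded uM (cost (m := m) phi).
Proof.
move=> x; rewrite ger0_norm ?cost_ge0//.
apply: le_trans (cost_le hzeta huM phi x) _.
by rewrite ler_wpM2l ?(weight_le _ _ hzeta)// ltW// (uM_gt0 hzeta huM).
Qed.

Lemma state_bounded_Hstar : state_bounded (uM / (1 - eta)) H.
Proof.
move=> x; apply: le_trans (Hstar_bound hzeta hH huM x) _.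
rewrite ler_wpM2l ?(weight_le _ _ hzeta)//.
by rewrite divr_ge0 ?subr_ge0 ?(ltW (eta_lt1 _ _ hzeta))// ltW// (uM_gt0 hzeta huM).
Qed.

(** On the uncontrolled level every policy serves at [mu], so this mean is the same for all of
    them. *)
Lemma pi_mean_cost phi : mean (fun i => cost (m := m) phi (i, false)) = g_mu m.
Proof.
have hc := geom_bounded_state _ _ false (state_bounded_cost phi).
have hh : geom_bounded zeta uM (h m).
  move=> i; rewrite ger0_norm ?h_ge0//; apply: le_trans (le_trans (ler_norm _) (hc i)).
  by rewrite /cost/= lerDr cost_rate_ge0.
rewrite /cost/=.
have -> : (fun i => cost_rate m (phi (i, false)) + h m i) =
   (fun i => (fun=> cost_rate m (mu m)) i + h m i) by apply/funext => i; rewrite rate0.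
rewrite (pi_meanD _ _ z1 zmu _ _ _ _ (geom_bounded_cst _ z1 _) hh) pi_mean_cst; congr (_ + _).
have cv : cvgn (series (fun i => h m i * rho ^+ i)).
  by apply: h_summable; rewrite rho_gt0 rho_lt1.
apply: cvg_lim => //; rewrite (_ : series _ =
  (fun n => (1 - rho) * series (fun i => h m i * rho ^+ i) n)).
  exact: cvgMr.
apply/funext => n; rewrite !seriesEnat/= mulr_sumr; apply: eq_bigr => i _.
by rewrite /pi_mu -mulrA (mulrC (h m i)).
Qed.

Lemma nneseries_pi_mean C f : geom_bounded zeta C f ->
  (\sum_(0 <= i <oo) (pi_mu m i * f i)%:E = (mean f)%:E)%E.
Proof.
move=> hf; rewrite /pi_mean -EFin_lim; last exact: pi_mean_cvg zmu _ _ hf.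
by congr (limn _); apply/funext => n; rewrite /= seriesEnat/= sumEFin.
Qed.

Lemma ssum_pi_mu1 C f : state_bounded C f ->
  ssum (fun x => (f x)%:E * (pi_mu1 m x)%:E)%E = (mean (fun i => f (i, true)))%:E.
Proof.
move=> hf; rewrite -(nneseries_pi_mean _ _ (geom_bounded_state _ _ _ hf)).
by apply: eq_eseriesr => i _; rewrite /pi_mu1/= mule0 adde0 -EFinM mulrC.
Qed.

Lemma ssum_pi_mu0 C f : state_bounded C f ->
  ssum (fun x => (f x)%:E * (pi_mu0 m x)%:E)%E = (mean (fun i => f (i, false)))%:E.
Proof.
move=> hf; rewrite -(nneseries_pi_mean _ _ (geom_bounded_state _ _ _ hf)).
by apply: eq_eseriesr => i _; rewrite /pi_mu0/= mule0 add0e -EFinM mulrC.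
Qed.

Lemma state_bounded1 : state_bounded 1 (fun=> 1).
Proof. by move=> x; rewrite normr1 mul1r exprn_ege1// ltW. Qed.

Section chains.
Variables (phi : policy m) (Z : chain_pair phi).

Lemma chX0 x : Prob Z (chX Z 0%N @^-1` [set x]) = (pi_mu0 m x)%:E.
Proof.
rewrite (measure_state_partition (chY Z 0%N)); last first.
  by apply: measurable_funPTI; exact: measurable_state.
(* Marginalising over the other chain; the factor 1 exhibits the total mass as the mean of the
   constant function one. *)
transitivity (ssum (fun y => (pi_mu0 m x)%:E * (1%:E * (pi_mu1 m y)%:E))%E).
  by apply: eq_ssum => y; rewrite mul1e -EFinM; exact: ch_init.
rewrite ssumZl; last by move=> y;
  rewrite mul1e lee_fin /pi_mu1; case: ifP => _ //; exact: pi_mu_ge0.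
by rewrite (ssum_pi_mu1 _ _ state_bounded1) pi_mean_cst// mule1.
Qed.

Lemma chY0 x : Prob Z (chY Z 0%N @^-1` [set x]) = (pi_mu1 m x)%:E.
Proof.
rewrite (measure_state_partition (chX Z 0%N)); last first.
  by apply: measurable_funPTI; exact: measurable_state.
transitivity (ssum (fun y => (pi_mu1 m x)%:E * (1%:E * (pi_mu0 m y)%:E))%E).
  by apply: eq_ssum => y; rewrite mul1e -EFinM mulrC setIC; exact: ch_init.
rewrite ssumZl; last by move=> y;
  rewrite mul1e lee_fin /pi_mu0; case: ifP => _ //; exact: pi_mu_ge0.
by rewrite (ssum_pi_mu0 _ _ state_bounded1) pi_mean_cst// mule1.
Qed.

Lemma iter_step_ge0 (f : state -> R) n : (forall x, 0 <= f x) ->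
  forall x, 0 <= iter n (step phi) f x.
Proof. by move=> f0; elim: n => // n IH x; rewrite iterS; exact: step_ge0. Qed.

(** The chain starts from the invariant law of a level that it never leaves. *)
Lemma integral_chX C f n : (forall x, 0 <= f x) -> state_bounded C f ->
  (\int[Prob Z]_w (f (chX Z n w))%:E = (mean (fun i => f (i, false)))%:E)%E.
Proof.
move=> f0 hf; rewrite (markov_integral _ _ (chX_markov Z))//.
rewrite integral_state//; last exact: iter_step_ge0.
have [D hD] := state_bounded_iter phi _ _ hf n.
under eq_ssum do rewrite setTI chX0.
rewrite (ssum_pi_mu0 _ _ hD); congr EFin.
rewrite -(pi_mean_iter_walk _ _ z1 zmu _ _ n (geom_bounded_state _ _ false hf)).
by congr (mean _); apply/funext => i; rewrite iter_step_walk.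
Qed.

Lemma integral_chY C f n : (forall x, 0 <= f x) -> state_bounded C f ->
  (\int[Prob Z]_w (f (chY Z n w))%:E =
     (mean (fun i => iter n (step phi) f (i, true)))%:E)%E.
Proof.
move=> f0 hf; rewrite (markov_integral _ _ (chY_markov Z))//.
rewrite integral_state//; last exact: iter_step_ge0.
have [D hD] := state_bounded_iter phi _ _ hf n.
under eq_ssum do rewrite setTI chY0.
by rewrite (ssum_pi_mu1 _ _ hD).
Qed.

(** By [integral_chY], the expected cost of the second chain at time [n]. *)
Let y n := mean (fun i => iter n (step phi) (cost phi) (i, true)).

Lemma integrable_of_finite (X : {RV (Prob Z) >-> state}) (f : state -> R) (e : R) :
  (forall x, 0 <= f x) -> (\int[Prob Z]_w (f (X w))%:E = e%:E)%E ->
  (Prob Z).-integrable setT (EFin \o (f \o X)).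
Proof.
move=> f0 he; apply/integrableP; split; first exact: measurable_EFin_state.
under eq_integral => w _ do rewrite /= ger0_norm//.
by rewrite he ltry.
Qed.

(** Each cost is integrable on its own, so linearity separates the two chains and their joint law
    drops out. *)
Lemma partial_saved_costE N :
  partial_saved_cost Z N = (\sum_(0 <= n < N) (g_mu m - y n))%:E.
Proof.
have c0 := cost_ge0 phi; have hc := state_bounded_cost phi.
have iX n := integral_chX _ _ n c0 hc; have iY n := integral_chY _ _ n c0 hc.
have jX n := integrable_of_finite _ _ _ c0 (iX n).
have jY n := integrable_of_finite _ _ _ c0 (iY n).
rewrite /partial_saved_cost unlock.
under eq_integral do rewrite -sumEFin.
rewrite integral_sum//=; last by move=> n; exact: (integrableB measurableT (jX n) (jY n)).
rewrite -sumEFin; apply: eq_bigr => n _.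
under eq_integral do rewrite EFinB.
rewrite integralB_EFin//; last 2 first.
- exact: jX.
- exact: jY.
by rewrite iX iY pi_mean_cost.
Qed.

Lemma saved_cost_term_bound : exists2 D, 0 <= D & exists2 theta, 0 <= theta < 1 &
  forall n, `|g_mu m - y n| <= D * theta ^+ n.
Proof.
have hc := state_bounded_cost phi.
have [D D0 [t t01 hD]] := step_ergodic _ _ z1 zmu (zeta_beta _ _ hzeta) phi _ _ hc.
rewrite pi_mean_cost in hD.
(* The [pi_mu]-mean of [zeta ^+ i], by which averaging multiplies the constant. *)
pose k : R := (1 - rho) / (1 - rho * zeta).
have k0 : 0 <= k.
  by rewrite divr_ge0 ?subr_ge0 ?(ltW (rho_lt1 m))// ltW// (rhoz_lt1 m zeta zmu).
exists (D * k); first exact: mulr_ge0.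
exists t => // n.
have [E hE] := state_bounded_iter phi _ _ hc n.
have hb : geom_bounded zeta (D * t ^+ n) (fun i => iter n (step phi) (cost phi) (i, true) - g_mu m).
  by move=> i; exact: (hD n (i, true)).
have := pi_mean_bound _ _ z1 zmu _ _ hb.
rewrite (pi_meanB _ _ z1 zmu _ _ _ _ (geom_bounded_state _ _ true hE) (geom_bounded_cst _ z1 _)).
rewrite pi_mean_cst distrC => /le_trans; apply.
by rewrite /k le_eqVlt; apply/orP; left; apply/eqP; ring.
Qed.

Lemma saved_cost_cvg : cvgn (series (fun n => g_mu m - y n)).
Proof.
have [D D0 [t /andP[t0 t1] hD]] := saved_cost_term_bound.
apply: normed_cvg; apply: (@series_le_cvg _ _ (geometric D t)).
- by move=> n; exact: normr_ge0.
- by move=> n; rewrite /= mulr_ge0// exprn_ge0.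
- exact: hD.
- by apply: is_cvg_geometric_series; rewrite ger0_norm.
Qed.

Lemma partial_saved_cost_EFin :
  partial_saved_cost Z = EFin \o series (fun n => g_mu m - y n).
Proof. by apply/funext => N; rewrite partial_saved_costE /= seriesEnat. Qed.

Lemma partial_saved_cost_cvg : cvgn (partial_saved_cost Z).
Proof.
rewrite partial_saved_cost_EFin; apply: cvgP; apply: cvg_EFin => //; last exact: saved_cost_cvg.
by near=> n.
Unshelve. all: by end_near. Qed.

Lemma saved_cost_ofE :
  saved_cost_of Z = (limn (series (fun n => g_mu m - y n)))%:E.
Proof.
rewrite /saved_cost_of partial_saved_cost_EFin EFin_lim//; exact: saved_cost_cvg.
Qed.

Let V n := mean (fun i => iter n (step phi) H (i, true)).

(** The monotone operator [step] is applied [n] times to [H - step H <= cost - g_mu]. *)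
Lemma iter_optimality_le n x :
  iter n (step phi) H x - iter n.+1 (step phi) H x <= iter n (step phi) (cost phi) x - g_mu m.
Proof.
elim: n x => [|n IH] x; first by have := Hstar_le hH phi x; rewrite /=; lra.
by rewrite !iterS -stepB -stepBC; exact: step_le.
Qed.

Lemma iter_optimal_ge : (forall x, g_mu m + H x = cost phi x + step phi H x) ->
  forall n x,
  iter n (step phi) (cost phi) x - g_mu m <= iter n (step phi) H x - iter n.+1 (step phi) H x.
Proof.
move=> e; elim=> [|n IH] x; first by have := e x; rewrite /=; lra.
by rewrite !iterS -stepB -stepBC; exact: step_le.
Qed.

Let hHn n : exists D, geom_bounded zeta D (fun i => iter n (step phi) H (i, true)).
Proof.
have [D hD] := state_bounded_iter phi _ _ state_bounded_Hstar n.
by exists D; exact: geom_bounded_state.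
Qed.

Let hcn n : exists D, geom_bounded zeta D (fun i => iter n (step phi) (cost phi) (i, true)).
Proof.
have [D hD] := state_bounded_iter phi _ _ (state_bounded_cost phi) n.
by exists D; exact: geom_bounded_state.
Qed.

Lemma iter_Hstar_cvg : V n @[n --> \oo] --> mean (fun i => H (i, false)).
Proof.
have [D D0 [t /andP[t0 t1] hD]] :=
  step_ergodic _ _ z1 zmu (zeta_beta _ _ hzeta) phi _ _ state_bounded_Hstar.
set p := mean _ in hD *.
pose k : R := (1 - rho) / (1 - rho * zeta).
have hV n : `|V n - p| <= D * k * t ^+ n.
  have [E hE] := hHn n.
  have hb : geom_bounded zeta (D * t ^+ n) (fun i => iter n (step phi) H (i, true) - p).
    by move=> i; exact: (hD n (i, true)).
  have := pi_mean_bound _ _ z1 zmu _ _ hb.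
  rewrite (pi_meanB _ _ z1 zmu _ _ _ _ hE (geom_bounded_cst _ z1 _)).
  rewrite pi_mean_cst => /le_trans; apply.
  by rewrite /k le_eqVlt; apply/orP; left; apply/eqP; ring.
have c0 : (fun n => D * k * t ^+ n) @ \oo --> (0 : R).
  rewrite -[X in _ --> X](mulr0 (D * k)); apply: cvgMr; apply: cvg_expr.
  by rewrite ger0_norm.
apply/cvgrPdist_le => e e0; near=> n; rewrite distrC (le_trans (hV n))//.
apply: le_trans (ler_norm _) _; near: n.
by move/cvgr0Pnorm_le: c0 => /(_ _ e0).
Unshelve. all: by end_near. Qed.

Let s := mean (fun i => H (i, false)) - mean (fun i => H (i, true)).

Let cVV : (fun N => V N - V 0%N) @ \oo --> s.
Proof. by apply: cvgB; [exact: iter_Hstar_cvg|exact: cvg_cst]. Qed.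

(** Averaging [iter_optimality_le] gives [g_mu - y n <= V n.+1 - V n]; the right side telescopes and
    [V] converges to the mean on the uncontrolled level. *)
Lemma saved_cost_of_le : (saved_cost_of Z <= s%:E)%E.
Proof.
rewrite saved_cost_ofE lee_fin -(cvg_lim _ cVV)//.
apply: ler_lim; [exact: saved_cost_cvg|by apply: cvgP; exact: cVV|].
near=> N; rewrite seriesEnat/= -telescope_sumr//; apply: ler_sum => n _.
have [[D hD] [E hE] [F hF]] := And3 (hHn n) (hHn n.+1) (hcn n).
rewrite -lerN2 !opprB.
have := pi_mean_le _ _ z1 zmu _ _ _ _ (geom_boundedD _ _ _ _ _ hD (geom_boundedN _ _ _ hE))
  (geom_boundedD _ _ _ _ _ hF (geom_boundedN _ _ _ (geom_bounded_cst _ z1 (g_mu m))))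
  (fun i => iter_optimality_le n (i, true)).
by rewrite (pi_meanB _ _ z1 zmu _ _ _ _ hD hE)
  (pi_meanB _ _ z1 zmu _ _ _ _ hF (geom_bounded_cst _ z1 _)) pi_mean_cst.
Unshelve. all: by end_near. Qed.

Lemma saved_cost_of_ge : (forall x, g_mu m + H x = cost phi x + step phi H x) ->
  (s%:E <= saved_cost_of Z)%E.
Proof.
move=> /iter_optimal_ge opt.
rewrite saved_cost_ofE lee_fin -(cvg_lim _ cVV)//.
apply: ler_lim; [by apply: cvgP; exact: cVV|exact: saved_cost_cvg|].
near=> N; rewrite seriesEnat/= -telescope_sumr//; apply: ler_sum => n _.
have [[D hD] [E hE] [F hF]] := And3 (hHn n) (hHn n.+1) (hcn n).
rewrite -lerN2 !opprB.
have := pi_mean_le _ _ z1 zmu _ _ _ _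
  (geom_boundedD _ _ _ _ _ hF (geom_boundedN _ _ _ (geom_bounded_cst _ z1 (g_mu m))))
  (geom_boundedD _ _ _ _ _ hD (geom_boundedN _ _ _ hE))
  (fun i => opt n (i, true)).
by rewrite (pi_meanB _ _ z1 zmu _ _ _ _ hD hE)
  (pi_meanB _ _ z1 zmu _ _ _ _ hF (geom_bounded_cst _ z1 _)) pi_mean_cst.
Unshelve. all: by end_near. Qed.

End chains.

Lemma saved_costE (Z : forall phi : policy m, chain_pair phi) :
  saved_cost Z = (mean (fun i => H (i, false)) - mean (fun i => H (i, true)))%:E.
Proof.
apply/eqP; rewrite eq_le; apply/andP; split.
  by apply: ge_ereal_sup => _ [phi _ <-]; exact: saved_cost_of_le.
have [phi hphi] := optimal_policy hH.
apply: le_trans (saved_cost_of_ge _ (Z phi) hphi) _.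
by apply: ereal_sup_ubound; exists phi.
Qed.

(** * Truncation and the total error *)

Lemma sum_pi_mu_le1 n : \sum_(0 <= i < n) pi_mu m i <= 1.
Proof.
have -> : \sum_(0 <= i < n) pi_mu m i = 1 - rho ^+ n.
  elim: n => [|n IH]; first by rewrite big_geq// expr0 subrr.
  by rewrite big_nat_recr//= IH /pi_mu exprS; ring.
by rewrite gerBl exprn_ge0// ltW// rho_gt0.
Qed.

Lemma s_tilde_error (e : R) : 0 < e ->
  `|mean (fun i => H (i, false)) - mean (fun i => H (i, true)) - s_tilde m zeta uM H e| <= e.
Proof.
move=> e0; have u0 := uM_gt0 hzeta huM; have e1 := eta_lt1 _ _ hzeta.
have r1 := rho_lt1 m; have q0 := rhoz_gt0 m _ z1; have q1 := rhoz_lt1 m _ zmu.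
have bw b := geom_bounded_state _ _ b state_bounded_Hstar.
rewrite -(pi_meanB _ _ z1 zmu _ _ _ _ (bw false) (bw true)).
(* The weights of the two levels add up: [1 / 2 + 1 = 3 / 2]. *)
have hD : geom_bounded zeta (3 / 2 * (uM / (1 - eta))) (fun i => H (i, false) - H (i, true)).
  move=> i; apply: le_trans (ler_normB _ _) _.
  have := Hstar_bound hzeta hH huM (i, false); have := Hstar_bound hzeta hH huM (i, true).
  by rewrite /Defs.weight/=; lra.
rewrite /s_tilde; set k := k_tilde _ _ _ _; set n := pos_part _.
have h1 := pi_mean_tail _ _ z1 zmu _ _ n hD.
pose x : R := e * (1 - eta) * (1 - rho * zeta) / (4 * uM * (1 - rho)).
have x0 : 0 < x by rewrite /x divr_gt0 ?mulr_gt0 ?subr_gt0.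
have hx : (rho * zeta) ^+ n <= x.
  have q01 : 0 < rho * zeta < 1 by rewrite q0.
  apply: le_trans (expr_ceil_log_le _ x q01 x0).
  (* The sum runs up to and including [k], so it has one term more than the exponent supplied by the
     ceiling; the power only gets smaller. *)
  by rewrite ler_wiXn2l ?(ltW q0) ?(ltW q1)// leq_pos_partD1.
rewrite -[X in `|X|](subrKA (\sum_(0 <= i < n) pi_mu m i * (H (i, false) - H (i, true)))).
(* Half of [e] is allotted to the truncated tail, which uses [3 / 8 * e], and half to value
   iteration, whose error is averaged with total mass at most 1. *)
apply: le_trans (ler_normD _ _) _; rewrite [leRHS](splitr e); apply: lerD.
  apply: le_trans h1 _.
  set c := _ * _ / _.
  have c0 : 0 <= c.
    rewrite /c divr_ge0 ?subr_ge0 ?(ltW q1)// mulr_ge0 ?subr_ge0 ?(ltW r1)//.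
    by rewrite mulr_ge0 ?divr_ge0 ?subr_ge0 ?(ltW e1) ?(ltW u0).
  apply: le_trans (ler_wpM2l c0 hx) _.
  have -> : c * x = 3 / 8 * e.
    rewrite /c /x; field; rewrite !lt0r_neq0// ?subr_gt0//.
  lra.
rewrite -sumrB; apply: (le_trans (ler_norm_sum _ _ _)).
apply: (@le_trans _ _ (\sum_(0 <= i < n) pi_mu m i * (e / 2))).
  rewrite !big_nat; apply: ler_sum => i /andP[_ ik].
  rewrite -[X in _ - X]/(pi_mu m i * _) -mulrBr normrM ger0_norm ?pi_mu_ge0//.
  rewrite ler_wpM2l ?pi_mu_ge0//.
  have e2 : 0 < e / 2 by rewrite divr_gt0.
  have ik' : i%:Z <= k.
    exact: ltn_pos_partD1.
  have := H_tilde_error hzeta hH huM _ _ _ e2 ik'; rewrite distrC; apply: le_trans.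
  by rewrite le_eqVlt; apply/orP; left; apply/eqP; congr (`|_|); ring.
by rewrite -mulr_suml; apply: ler_piMl; [rewrite divr_ge0// ltW|exact: sum_pi_mu_le1].
Qed.

End saved_cost.

Theorem theorem6p2 (R : realType) (m : model R) (zeta uM : R)
    (Hstar : state -> R) (Z : forall phi : policy m, chain_pair phi)
    (eps : R)
    (hzeta : admissible_zeta m zeta)
    (hHstar : is_Hstar m zeta Hstar)
    (huM : is_uM m zeta uM)
    (heps : 0 < eps) :
  [/\ forall phi : policy m, cvgn (partial_saved_cost (Z phi)),
      forall i : nat, i%:Z <= k_tilde m zeta uM eps ->
        `|Hstar (i, true)
          - H_tilde m zeta uM Hstar (eps / 2) (k_tilde m zeta uM eps) i|
        <= eps / 2
    & (`|saved_cost Z - (s_tilde m zeta uM Hstar eps)%:E| <= eps%:E)%E].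
Proof.
split.
- by move=> phi; exact: partial_saved_cost_cvg hzeta huM _ _.
- by move=> i ik; apply: (H_tilde_error hzeta hHstar huM) => //; exact: divr_gt0.
- by rewrite (saved_costE hzeta hHstar huM) -EFinB lee_fin; exact: s_tilde_error.
Qed.
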